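(* Let $v,w\in\mathfrak{S}_n$ with $v\le w$ in Bruhat order. The Bruhat interval polytope $Q_{v,w}$ is combinatorially equivalent to a cube if and only if $Q_{v,w}$ is toric and the Bruhat interval $[v,w]$ is a Boolean algebra.
   Context: $\mathfrak{S}_n$ is the symmetric group on $\{1,\dots,n\}$, $\ell(\cdot)$ is the length with respect to the simple transpositions $s_i=(i,i+1)$, and $\le$ is Bruhat order. For $v\le w$, $[v,w]=\{z\in\mathfrak{S}_n\mid v\le z\le w\}$ (a poset under Bruhat order), and the Bruhat interval polytope $Q_{v,w}$ is the convex hull in $\mathbb{R}^n$ of the points $(z(1),\dots,z(n))$ for $z\in[v,w]$. $Q_{v,w}$ is called toric if $\dim Q_{v,w}=\ell(w)-\ell(v)$. Two polytopes are combinatorially equivalent if their face posets are isomorphic. ''$[v,w]$ is a Boolean algebra'' means that it is isomorphic as a poset to the poset of all subsets of a finite set ordered by inclusion. *)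

(* Defs.v *)
From HB Require Import structures.
From mathcomp Require Import all_boot all_order all_fingroup all_algebra.
From mathcomp Require Import mathcomp_extra boolp classical_sets functions reals.
From mathcomp Require Import topology convex.

Set Implicit Arguments.
Unset Strict Implicit.
Unset Printing Implicit Defensive.

Import Order.TTheory GRing.Theory Num.Theory.

Local Open Scope classical_set_scope.
Local Open Scope ring_scope.

Definition simple_transpositions (n : nat) : {set 'S_n} :=
  [set s | [exists i : 'I_n, [exists j : 'I_n,
    (nat_of_ord j == i.+1) && (s == tperm i j)]]]%SET.

Definition is_word (n : nat) (w : 'S_n) (k : nat) : bool :=
  [exists s : k.-tuple 'S_n,
    all (mem (simple_transpositions n)) s && (w == (\prod_(x <- s) x)%g)].

Lemma simple_transpositions_gen (n : nat) :
  <<simple_transpositions n>>%g = [set: 'S_n]%SET.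
Proof.
apply/eqP; rewrite finset.eqEsubset finset.subsetT /=; apply/fintype.subsetP => w _.
have [ts -> _] := prod_tpermP w; apply: group_prod => -[/= a b] _.
have tp_lt (k : nat) (x y : 'I_n) : nat_of_ord y = (x + k.+1)%N ->
    tperm x y \in <<simple_transpositions n>>%g.
  elim: k x y => [|k IH] x y xy.
    apply: mem_gen; rewrite inE; apply/existsP; exists x; apply/existsP.
    by exists y; rewrite xy addn1 !eqxx.
  have zn : (x + k.+1 < n)%N.
    by apply: ltn_trans (ltn_ord y); rewrite xy ltn_add2l.
  pose z := Ordinal zn.
  have xz : tperm x z \in <<simple_transpositions n>>%g by apply: IH.
  have zy : tperm z y \in <<simple_transpositions n>>%g.
    apply: mem_gen; rewrite inE; apply/existsP; exists z; apply/existsP.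
    by exists y; rewrite xy /= -addnS !eqxx.
  have -> : tperm x y = (tperm x z ^ tperm z y)%g.
    rewrite tpermJ tpermL tpermD //.
      by rewrite -val_eqE /= -[X in _ != X]addn0 eqn_add2l.
    by rewrite -val_eqE /= xy -[X in _ != X]addn0 eqn_add2l.
  by rewrite groupJ.
case: (ltngtP a b) => [ab|ba|/val_inj ->].
- by apply: (tp_lt (b - a.+1)%N); rewrite addnS -addSn subnKC.
- by rewrite tpermC; apply: (tp_lt (a - b.+1)%N); rewrite addnS -addSn subnKC.
- by rewrite tperm1 group1.
Qed.

Lemma is_word_ex (n : nat) (w : 'S_n) : exists k, is_word w k.
Proof.
have : w \in <<simple_transpositions n>>%g.
  by rewrite simple_transpositions_gen finset.in_setT.
case/gen_prodgP => k [c cS ->]; exists k; apply/existsP.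
exists [tuple c i | i < k]; apply/andP; split.
  by apply/allP => x /mapP [i _ ->]; apply: cS.
by rewrite big_tuple; apply/eqP/eq_bigr => i _; rewrite tnth_mktuple.
Qed.

Definition perm_length (n : nat) (w : 'S_n) : nat := ex_minn (is_word_ex w).

(* The product of 'S_n composes left to right. The set of transpositions is
   closed under conjugation, so multiplying by them on the left instead would
   give the same relation. *)
Definition bruhat_step (n : nat) (x y : 'S_n) : bool :=
  [exists i : 'I_n, [exists j : 'I_n, y == (x * tperm i j)%g]]
  && (perm_length x < perm_length y)%N.

Definition bruhat (n : nat) (x y : 'S_n) : bool :=
  connect (@bruhat_step n) x y.

Definition bruhat_interval (n : nat) (v w : 'S_n) : set 'S_n :=
  [set z | bruhat v z && bruhat z w].

Definition poset_iso (T U : Type) (A : set T) (leT : T -> T -> Prop)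
    (B : set U) (leU : U -> U -> Prop) : Prop :=
  exists2 f : T -> U, set_bij A B f &
    forall x y, A x -> A y -> (leT x y <-> leU (f x) (f y)).

Definition boolean_interval (n : nat) (v w : 'S_n) : Prop :=
  exists T : finType,
    poset_iso (bruhat_interval v w) (fun x y => bruhat x y)
              [set: {set T}] (fun X Y => X \subset Y).

Definition convex_hull (R : realType) (n : nat) (A : set 'rV[R]_n) :
    set 'rV[R]_n :=
  smallest (@convex_set R 'rV[R]_n) A.

Definition affine_hull (R : realType) (n : nat) (A : set 'rV[R]_n) :
    set 'rV[R]_n :=
  [set y | exists (k : nat) (x : 'I_k -> 'rV[R]_n) (a : 'I_k -> R),
    [/\ forall i, A (x i), \sum_i a i = 1 & y = \sum_i a i *: x i]].

(* The affine hull of P is a translate of a d-dimensional linear subspace,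
   here the row space of U. *)
Definition has_dim (R : realType) (n : nat) (P : set 'rV[R]_n) (d : nat) :
    Prop :=
  exists (x0 : 'rV[R]_n) (U : 'M[R]_n),
    affine_hull P = [set y | (y - x0 <= U)%MS] /\ \rank U = d.

(* Taking c = 0 shows that P itself (b = 0) and the empty set (b = 1) are
   faces. *)
Definition is_face (R : realType) (n : nat) (P F : set 'rV[R]_n) : Prop :=
  exists (c : 'rV[R]_n) (b : R),
    (forall x, P x -> \sum_i c 0 i * x 0 i <= b) /\
    F = [set x | P x /\ \sum_i c 0 i * x 0 i = b].

Definition comb_equiv (R : realType) (m n : nat)
    (P : set 'rV[R]_m) (Q : set 'rV[R]_n) : Prop :=
  poset_iso (is_face P) (fun F G => F `<=` G)
            (is_face Q) (fun F G => F `<=` G).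

Definition unit_cube (R : realType) (d : nat) : set 'rV[R]_d :=
  [set x | forall i, 0 <= x 0 i <= 1].
Arguments unit_cube R d : clear implicits.

Definition perm_point (R : realType) (n : nat) (z : 'S_n) : 'rV[R]_n :=
  \row_i (z i).+1%:R.

Definition bruhat_polytope (R : realType) (n : nat) (v w : 'S_n) :
    set 'rV[R]_n :=
  convex_hull (@perm_point R n @` bruhat_interval v w).
Arguments bruhat_polytope R {n} v w.

Definition toric (R : realType) (n : nat) (v w : 'S_n) : Prop :=
  has_dim (bruhat_polytope R v w) (perm_length w - perm_length v)%N.

(* Main.v *)
(** A diamond of Bruhat covers consists of four coplanar points in convex position, and any
    two atoms of a Bruhat interval are joined by diamonds inside the interval.  So the
    transpositions along any saturated chain of [x,y] span all differences z - x with z in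
    [x,y].  With the generalized lifting property of Tsukerman and Williams it follows that
    a linear functional attaining its maximum over [x,y] at both x and y is constant.

    If Q_{v,w} is a d-cube, each facet through v is therefore an order ideal, so the labels
    S(z) of the vertices by subsets of {1,...,d} increase along the Bruhat order.  Hence
    d <= dim Q <= l(w) - l(v) <= d.  As the atoms of [z,w] span the affine hull of [z,w],
    every set obtained from S(z) by adding one element labels an atom, so S is an
    isomorphism of posets.

    Conversely, label a toric Boolean interval by subsets.  The sets {z : i notin S(z)} and
    {z : i in S(z)} are Bruhat intervals of smaller dimension; a functional constant on one
    of them can be chosen to be strictly larger on the other, because diamonds are in convex
    position.  With these 2d facets every vertex is simple, and this determines all faces. *)
Require Import Defs.
From mathcomp Require Import all_boot all_order all_fingroup all_algebra.
From mathcomp Require Import reals.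
From mathcomp Require Import boolp classical_sets functions convex.
From mathcomp Require Import interval_inference zify ring lra.

Set Implicit Arguments.
Unset Strict Implicit.
Unset Printing Implicit Defensive.

Import Order.TTheory GRing.Theory Num.Theory.

(** * Length and inversions *)

Section Inversions.
Variable n : nat.
Implicit Types (x y u v : 'S_n) (i j a b : 'I_n).

Definition ninv x : nat := \sum_(a < n) \sum_(b < n) ((a < b) && (x b < x a)).

Lemma sum_pair_split (E : 'I_n -> 'I_n -> nat) i j : i != j ->
  \sum_a \sum_b E a b =
    E i i + E j j + E i j + E j i
    + \sum_(a | (a != i) && (a != j)) (E a i + E i a + E a j + E j a)
    + \sum_(a | (a != i) && (a != j)) \sum_(b | (b != i) && (b != j)) E a b.
Proof.
move=> ij; have ji : j != i by rewrite eq_sym.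
have split1 (f : 'I_n -> nat) :
    \sum_a f a = f i + f j + \sum_(a | (a != i) && (a != j)) f a.
  by rewrite (bigD1 i) //= (bigD1 j) //= addnA.
rewrite split1 !(split1 (E _)).
under [X in _ + X = _]eq_bigr => a _ do rewrite split1.
rewrite !big_split /=; lia.
Qed.

Lemma swapL x i j : (tperm i j * x)%g i = x j.
Proof. by rewrite permM tpermL. Qed.
Lemma swapR x i j : (tperm i j * x)%g j = x i.
Proof. by rewrite permM tpermR. Qed.
Lemma swapD x i j a : a != i -> a != j -> (tperm i j * x)%g a = x a.
Proof. by move=> ai aj; rewrite permM tpermD // eq_sym. Qed.

Lemma perm_val_neq x i j : i != j -> (x i != x j :> nat).
Proof. by move=> ij; rewrite val_eqE (inj_eq perm_inj). Qed.

Lemma ltn_ord_neq i j : i < j -> i != j.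
Proof. by move=> ij; rewrite -val_eqE /= ltn_eqF. Qed.

(** The pair [(i, j)] becomes an inversion. A position [a] strictly between in place and in value
    contributes two more; for any other [a] the pairs with [i] and [j] keep their total. *)
Lemma ninv_swap x i j : i < j -> x i < x j ->
  ninv (tperm i j * x)%g =
    (ninv x + (\sum_(a : 'I_n | (i < a < j) && (x i < x a < x j)) 2).+1)%N.
Proof.
move=> ij xij; have nij := ltn_ord_neq ij.
rewrite /ninv !(sum_pair_split _ nij) !swapL !swapR.
set S1 := (X in _ + _ + X = _); set S2 := (X in _ = _ + _ + X + _).
have -> : S1 = S2.
  apply: eq_bigr => a /andP[ai aj]; apply: eq_bigr => b /andP[bi bj].
  by rewrite !swapD.
have -> : \sum_(a : 'I_n | (i < a < j) && (x i < x a < x j)) 2 =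
   \sum_(a : 'I_n | (a != i) && (a != j)) 2 * ((i < a < j) && (x i < x a < x j)).
  rewrite [RHS](bigID (fun a : 'I_n => (i < a < j) && (x i < x a < x j))) /=.
  rewrite [X in _ = _ + X]big1 ?addn0; last first.
    by move=> a /andP[_ /negbTE->].
  apply: eq_big => [a|a /andP[-> ->] //].
  case H: ((i < a < j) && (x i < x a < x j)); rewrite ?andbF ?andbT //.
  by case/andP: H => /andP[ia aj] _; rewrite eq_sym (ltn_ord_neq ia) (ltn_ord_neq aj).
set T1 := (X in _ + X + _ = _); set T2 := (X in _ = _ + X + _ + _).
set T3 := (X in _ = _ + X.+1).
have -> : T1 = T2 + T3.
  rewrite /T1 /T2 /T3 -big_split; apply: eq_bigr => a /andP[ai aj] /=.
  rewrite !swapD //.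
  move: ai aj (perm_val_neq x ai) (perm_val_neq x aj); rewrite -!val_eqE /=.
  move: (nat_of_ord (x a)) (nat_of_ord (x i)) (nat_of_ord (x j)) xij => A I J.
  move: (nat_of_ord a) (nat_of_ord i) (nat_of_ord j) ij => a' i' j'. lia.
rewrite !ltnn ij xij /= [j < i]ltnNge (ltnW ij) /= [x j < x i]ltnNge (ltnW xij) /=.
lia.
Qed.


Lemma ninv_swap_gt x i j : i < j -> x i < x j -> ninv x < ninv (tperm i j * x)%g.
Proof. by move=> ij xij; rewrite ninv_swap // addnS ltnS leq_addr. Qed.

Lemma ninv_swapS x i j : i < j -> x i < x j ->
  (forall a, i < a < j -> x i < x a < x j = false) ->
  ninv (tperm i j * x)%g = (ninv x).+1.
Proof.
move=> ij xij H; rewrite ninv_swap // big1 ?addn1 // => a /andP[/H->].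
by [].
Qed.

Lemma ninv_swapS_between x i j : i < j -> x i < x j ->
  ninv (tperm i j * x)%g = (ninv x).+1 ->
  forall a, i < a < j -> x i < x a < x j = false.
Proof.
move=> ij xij; rewrite ninv_swap // addnS => -[/eqP]; rewrite -[X in _ == X]addn0 eqn_add2l.
rewrite sum_nat_eq0 => /forallP H a ija; move: (H a); rewrite ija /=.
by case: (x i < x a < x j).
Qed.

(** Bruhat steps are defined by swapping values on the right; the development swaps positions on the
    left. *)
Lemma mulg_tperm x a b :
  (x * tperm a b)%g = (tperm (x^-1%g a) (x^-1%g b) * x)%g.
Proof. by rewrite -tpermJ /conjg invgK mulgA mulgKV. Qed.

(** No value lies strictly between [a] and [a + 1], so only one inversion changes. *)
Lemma ninv_mul_simple x a b : b = a.+1 :> nat ->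
  if x^-1%g a < x^-1%g b then ninv (x * tperm a b)%g = (ninv x).+1
  else ninv x = (ninv (x * tperm a b)%g).+1.
Proof.
move=> ab; rewrite mulg_tperm.
set i := x^-1%g a; set j := x^-1%g b.
have xi : x i = a by rewrite permKV.
have xj : x j = b by rewrite permKV.
have nij : i != j by apply/eqP=> E; move: ab; rewrite -xi -xj E; lia.
case: ltnP => ij.
  by apply: ninv_swapS; rewrite ?xi ?xj ?ab // => c _; lia.
have ji : j < i by rewrite ltn_neqAle eq_sym nij.
have := @ninv_swapS (tperm j i * x)%g j i ji.
rewrite swapL swapR xi xj ab mulgA tperm2 mul1g [tperm j i]tpermC => -> // c _.
by lia.
Qed.

Lemma ninv1 : ninv 1%g = 0.
Proof. by rewrite /ninv big1 // => a _; rewrite big1 // => b _; rewrite !perm1; lia. Qed.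

Lemma word_ninv w k : is_word w k -> ninv w <= k.
Proof.
case/existsP=> -[s /eqP sk] /andP[] /=; elim/last_ind: s w k sk => [|s a IH] w k.
  by move=> <- _ /eqP ->; rewrite big_nil ninv1.
rewrite size_rcons => <-; rewrite all_rcons big_rcons /= => /andP[].
rewrite inE => /existsP[i /existsP[j /andP[/eqP ij /eqP ->]]] /= sa /eqP ->.
set p := (X in (X * _)%g).
have := IH p _ erefl sa (eqxx _).
by move: (ninv_mul_simple p ij); case: ifP => _ ->; [|move/ltnW/leqW].
Qed.

(** Without descents the inverse of [x] is increasing, and an increasing self-map [f] of an initial
    segment satisfies both [k <= f k] and [f k <= k]. *)
Lemma perm_descent x : x != 1%g ->
  exists a b : 'I_n, b = a.+1 :> nat /\ x^-1%g b < x^-1%g a.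
Proof.
move=> x1.
have [/existsP[a /existsP[b /andP[/eqP ab d]]]|H0] := boolP
  [exists a : 'I_n, exists b : 'I_n, (val b == a.+1) && (x^-1%g b < x^-1%g a)].
  by exists a, b.
have H (a b : 'I_n) : b = a.+1 :> nat -> x^-1%g a <= x^-1%g b.
  move=> ab; rewrite leqNgt; apply: contra H0 => d.
  by apply/existsP; exists a; apply/existsP; exists b; rewrite /= ab eqxx.
case/eqP: x1.
have mono (k : nat) (a b : 'I_n) : b = (a + k.+1)%N :> nat -> x^-1%g a < x^-1%g b.
  elim: k b => [|k IH] b ab.
    rewrite addn1 in ab; move: (H _ _ ab).
    rewrite leq_eqVlt => /orP[/eqP/val_inj/perm_inj E|//].
    by move: ab; rewrite E; lia.
  have cn : a + k.+1 < n by have := ltn_ord b; lia.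
  apply: (ltn_trans (IH (Ordinal cn) erefl)).
  rewrite addnS in ab; move: (H (Ordinal cn) _ ab).
  rewrite leq_eqVlt => /orP[/eqP/val_inj/perm_inj E|//].
  by move: ab; rewrite -E /=; lia.
have ge (k : nat) (a : 'I_n) : a = k :> nat -> k <= x^-1%g a.
  elim: k a => // k IH a ak.
  have kn : k < n by have := ltn_ord a; lia.
  apply: (leq_ltn_trans (IH (Ordinal kn) erefl)).
  by apply: (mono 0); rewrite /= ak addn1.
have le (k : nat) (a : 'I_n) : (a + k.+1 = n)%N -> x^-1%g a + k.+1 <= n.
  elim: k a => [|k IH] a ak; first by have := ltn_ord (x^-1%g a); lia.
  have kn : a.+1 < n by lia.
  have := IH (Ordinal kn); rewrite /= => /(_ ltac:(lia)).
  have := mono 0 a (Ordinal kn) ltac:(by rewrite /= addn1); lia.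
apply: invg_inj; rewrite invg1; apply/permP => a.
rewrite perm1; apply: val_inj => /=; apply/eqP; rewrite eqn_leq (ge _ _ erefl) andbT.
have an := ltn_ord a; have Ea : (a + (n - a).-1.+1 = n)%N by lia.
by have := le _ _ Ea; move: an; move: (nat_of_ord (x^-1%g a)) (nat_of_ord a) => X A; lia.
Qed.

(** Undoing a descent by an adjacent transposition lowers [ninv] by one, so induction sorts [w] in
    exactly [ninv w] letters. *)
Lemma ninv_word w : is_word w (ninv w).
Proof.
move: {2}(ninv w) (erefl (ninv w)) => k; elim: k w => [|k IH] w wk.
  case: (eqVneq w 1%g) => [->|/perm_descent[a [b [ab d]]]].
    rewrite ninv1; apply/existsP; exists [tuple]; rewrite /= big_nil eqxx; exact.
  by move: (ninv_mul_simple w ab); rewrite ltnNge (ltnW d) /= wk.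
case: (eqVneq w 1%g) => [E|/perm_descent[a [b [ab d]]]].
  by move: wk; rewrite E ninv1.
move: (ninv_mul_simple w ab); rewrite ltnNge (ltnW d) /= => E.
have /IH : ninv (w * tperm a b)%g = k by lia.
rewrite wk; move: E; rewrite wk => -[<-] /existsP[s /andP[sa /eqP se]].
apply/existsP; exists [tuple of rcons s (tperm a b)].
rewrite /= all_rcons sa andbT big_rcons /= -se -mulgA tperm2 mulg1 eqxx andbT.
by rewrite inE; apply/existsP; exists a; apply/existsP; exists b; rewrite ab !eqxx.
Qed.

Lemma perm_length_ninv w : perm_length w = ninv w.
Proof.
rewrite /perm_length; case: ex_minnP => k kw kmin.
by apply/eqP; rewrite eqn_leq kmin ?ninv_word // word_ninv.
Qed.

(** Swapping an increasing pair lengthens and swapping a decreasing pair shortens, so comparing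
    lengths amounts to comparing the two swapped values. *)
Lemma bruhat_stepP x y : reflect
  (exists i j, [/\ i < j, x i < x j & y = (tperm i j * x)%g]) (bruhat_step x y).
Proof.
rewrite /bruhat_step !perm_length_ninv; apply: (iffP andP).
  case=> /existsP[a /existsP[b /eqP ->]]; rewrite mulg_tperm.
  set i := x^-1%g a; set j := x^-1%g b.
  case: (ltngtP i j) => [ij|ji|/val_inj->]; last by rewrite tperm1 mul1g ltnn.
  - case: (ltngtP (x i) (x j)) => [xij|xji|/val_inj/perm_inj E]; last by rewrite E ltnn in ij.
      by exists i, j.
    move=> H; have := @ninv_swap_gt (tperm i j * x)%g i j ij.
    by rewrite swapL swapR mulgA tperm2 mul1g => /(_ xji); move: H; lia.
  - rewrite tpermC; case: (ltngtP (x j) (x i)) => [xij|xji|/val_inj/perm_inj E];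
      last by rewrite E ltnn in ji.
      by exists j, i.
    move=> H; have := @ninv_swap_gt (tperm j i * x)%g j i ji.
    by rewrite swapL swapR mulgA tperm2 mul1g => /(_ xji); move: H; lia.
case=> i [j [ij xij ->]]; split; last exact: ninv_swap_gt.
apply/existsP; exists (x i); apply/existsP; exists (x j).
by rewrite mulg_tperm !permK.
Qed.

End Inversions.

(** * Bruhat order by rank functions *)

Section Rank.
Variable n : nat.
Implicit Types (x y u v : 'S_n) (i j a b k : 'I_n) (p q : nat).

(** The rank matrix of a permutation. Its entrywise comparison [rkle] is the tableau criterion for
    Bruhat order, see [bruhatP]. *)
Definition rk x p q : nat := \sum_(k < n | k < p) (q <= x k).

Definition rkle u v := forall p q, rk u p q <= rk v p q.

Lemma rkle_trans v u x : rkle u v -> rkle v x -> rkle u x.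
Proof. by move=> uv vx p q; apply: leq_trans (uv p q) (vx p q). Qed.

Lemma rk_split x p p' q : p <= p' ->
  rk x p' q = rk x p q + \sum_(k < n | p <= k < p') (q <= x k).
Proof.
move=> pp'; rewrite /rk (bigID (fun k : 'I_n => k < p)) /=.
by congr (_ + _); apply: eq_bigl => k; lia.
Qed.

Lemma window_le x y q q' p p' :
  (forall k, p <= k < p' -> q <= x k -> q' <= y k) ->
  \sum_(k < n | p <= k < p') (q <= x k) <= \sum_(k < n | p <= k < p') (q' <= y k).
Proof. by move=> H; apply: leq_sum => k /H; case: leqP => // _ ->. Qed.

Lemma window_lt x y q q' p p' k0 : p <= k0 < p' -> x k0 < q -> q' <= y k0 ->
  (forall k, p <= k < p' -> q <= x k -> q' <= y k) ->
  \sum_(k < n | p <= k < p') (q <= x k) < \sum_(k < n | p <= k < p') (q' <= y k).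
Proof.
move=> k0p xk0 yk0 H; rewrite (bigD1 k0) //= [X in _ < X](bigD1 k0) //=.
rewrite [q <= _]leqNgt xk0 yk0 /= add0n add1n ltnS; apply: leq_sum => k /andP[/H kp _].
by move: kp; case: leqP => // _ ->.
Qed.

(** Only a [p] separating the two positions together with a [q] separating the two values notices
    the swap: the rank matrix grows by one on a rectangle. *)
Lemma rk_swap x i j p q : i < j -> x i < x j ->
  rk (tperm i j * x)%g p q = rk x p q + ((i < p <= j) && (x i < q <= x j)).
Proof.
move=> ij xij; have nij := ltn_ord_neq ij; rewrite /rk.
have splt (z : 'S_n) : \sum_(k < n | k < p) (q <= z k) =
    ((i < p) && (q <= z i)) + ((j < p) && (q <= z j))
    + \sum_(k < n | (k != i) && (k != j)) ((k < p) && (q <= z k)).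
  rewrite big_mkcond /= (bigD1 i) //= (bigD1 j) 1?eq_sym //= addnA.
  congr (_ + _ + _); try by case: (_ < p).
  by apply: eq_bigr => k _; case: (k < p).
rewrite !splt swapL swapR.
under eq_bigr => k /andP[ki kj] do rewrite swapD //.
by move: (bigop _ _ _) => S; lia.
Qed.

Lemma swap_le u v i j : rkle u v -> i < j -> u i < u j ->
  (forall p q, i < p <= j -> u i < q <= u j -> rk u p q < rk v p q) ->
  rkle (tperm i j * u)%g v.
Proof.
move=> uv ij uij H p q; rewrite rk_swap //; move: (uv p q) (H p q).
by case: (i < p <= j) => //=; case: (u i < q <= u j) => //=; lia.
Qed.

Lemma swap_ge u v i j : rkle u v -> i < j -> v j < v i ->
  (forall p q, i < p <= j -> v j < q <= v i -> rk u p q < rk v p q) ->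
  rkle u (tperm i j * v)%g.
Proof.
move=> uv ij vij H p q.
have := @rk_swap (tperm i j * v)%g i j p q ij; rewrite swapL swapR mulgA tperm2 mul1g.
move=> /(_ vij) E; move: (uv p q) (H p q).
by case: (i < p <= j) E => //=; case: (v j < q <= v i) => //=; lia.
Qed.

Lemma rkle_swap u i j : i < j -> u i < u j -> rkle u (tperm i j * u)%g.
Proof. by move=> ij uij p q; rewrite rk_swap // leq_addr. Qed.

Lemma rk_prefix u v i q : (forall k, k < i -> u k = v k) -> rk u i q = rk v i q.
Proof. by move=> H; apply: eq_bigr => k /H->. Qed.

(** Compare the ranks at [(i + 1, u i)]: the prefixes agree, so position [i] must count for [v] as
    well. *)
Lemma first_diff_le u v i :
  rkle u v -> (forall k, k < i -> u k = v k) -> u i <= v i.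
Proof.
move=> uv H; move: (uv i.+1 (u i)); rewrite !(@rk_split _ i i.+1) //.
rewrite (rk_prefix _ H) leq_add2l !(big_pred1 i) ?leqnn; last first.
- by move=> k; rewrite /= -val_eqE /=; lia.
- by move=> k; rewrite /= -val_eqE /=; lia.
by case: (u i <= v i).
Qed.

Lemma first_diff u v : u != v ->
  exists i, (forall k, k < i -> u k = v k) /\ u i != v i.
Proof.
move=> uv; have [i0 Hi0] : exists i, u i != v i.
  apply/existsP; apply: contraR uv; rewrite negb_exists => /forallP H.
  by apply/eqP/permP => i; apply/eqP; rewrite -[_ == _]negbK.
case: (@arg_minnP _ i0 (fun i => u i != v i) (fun i => i : nat) Hi0) => i ui imin.
exists i; split=> // k ki; apply/eqP; apply: contraLR ki => /imin.
by rewrite -leqNgt.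
Qed.

Lemma first_rise u v i : rkle u v -> (forall k, k < i -> u k = v k) ->
  u i != v i -> exists j, [/\ i < j, u i < u j <= v i &
    forall k, i < k < j -> u i < u k <= v i = false].
Proof.
move=> uv H ne; have := first_diff_le uv H.
rewrite leq_eqVlt val_eqE (negbTE ne) /= => uvi.
pose P j := (i < j) && (u i < u j <= v i).
(* The value [v i] occurs in [u] after position [i], because the earlier values of [u] and [v]
   agree. *)
have P0 : P (u^-1%g (v i)).
  rewrite /P permKV uvi leqnn !andbT ltnNge leq_eqVlt; apply/negP=> /orP[/eqP/val_inj E|ji].
    by case/eqP: ne; rewrite -{1}E permKV.
  by move: (H _ ji); rewrite permKV => /perm_inj E; move: ji; rewrite -E ltnn.
case: (@arg_minnP _ _ P (fun i => i : nat) P0) => j /andP[ij uj] jmin.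
exists j; split=> // k /andP[ik kj]; apply/negP=> uk.
by have := jmin k; rewrite /P ik uk => /(_ isT); lia.
Qed.

(** On the rectangle of the swap, the entries of [u] counted between [i] and [p] exceed [v i],
    because [j] is the first rise. There are at most as many such entries in [v], and [v] has one
    more counted entry, at [i] itself. *)
Lemma first_rise_swap u v i j : rkle u v -> (forall k, k < i -> u k = v k) ->
  i < j -> u i < u j <= v i -> (forall k, i < k < j -> u i < u k <= v i = false) ->
  rkle (tperm i j * u)%g v /\ ninv (tperm i j * u)%g = (ninv u).+1.
Proof.
move=> uv H ij /andP[uij ujv] Hj; split; last first.
  by apply: ninv_swapS => // a /Hj; lia.
apply: swap_le => // p q /andP[ip pj] /andP[uq qu].
rewrite !(@rk_split _ i p) ?(ltnW ip) // (rk_prefix _ H) ltn_add2l.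
apply: (@leq_ltn_trans (\sum_(k < n | i <= k < p) ((v i).+1 <= u k))).
  apply: window_le => k /andP[ik kp] qk.
  have ik' : i < k.
    by rewrite ltn_neqAle ik andbT; apply/eqP=> E; move: qk; rewrite -(val_inj E); lia.
  by have := Hj k; rewrite ik' (leq_trans kp pj) => /(_ isT); lia.
apply: (@leq_ltn_trans (\sum_(k < n | i <= k < p) ((v i).+1 <= v k))).
  by have := uv p (v i).+1; rewrite !(@rk_split _ i p) ?(ltnW ip) // (rk_prefix _ H) leq_add2l.
by apply: (@window_lt _ _ _ _ _ _ i); rewrite ?leqnn ?ip //; lia.
Qed.

Definition step x y := exists i j, [/\ i < j, x i < x j & y = (tperm i j * x)%g].

Lemma step_rkle x y : step x y -> rkle x y.
Proof. by case=> i [j [ij xij ->]]; apply: rkle_swap. Qed.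

Lemma step_ninv x y : step x y -> ninv x < ninv y.
Proof. by case=> i [j [ij xij ->]]; apply: ninv_swap_gt. Qed.

Definition cov x y := step x y /\ ninv y = (ninv x).+1.

Lemma ninv_bound x : ninv x <= n * n.
Proof.
apply: (@leq_trans (\sum_(a < n) \sum_(b < n) 1)).
  by apply: leq_sum => a _; apply: leq_sum => b _; apply: leq_b1.
by rewrite !sum_nat_const !card_ord muln1.
Qed.

Lemma rkle_cov u v : rkle u v -> u != v -> exists2 a, cov u a & rkle a v.
Proof.
move=> uv ne; have [i [H nei]] := first_diff ne.
have [j [ij uj Hj]] := first_rise uv H nei.
have [tv ti] := first_rise_swap uv H ij uj Hj.
exists (tperm i j * u)%g => //; split=> //; exists i, j; split=> //; lia.
Qed.

(** As long as [u] differs from [v], [rkle_cov] climbs to a cover of [u] still below [v]; this stops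
    because [ninv] is at most [n * n]. *)
Lemma bruhatP u v : reflect (rkle u v) (bruhat u v).
Proof.
apply: (iffP idP) => [/connectP[s]|].
  elim: s u => [|a s IH] u /=; first by move=> _ ->.
  by move=> /andP[/bruhat_stepP/step_rkle ua sa] E; apply: rkle_trans ua (IH _ sa E).
move: {2}(n * n - ninv u) (leqnn (n * n - ninv u)) => m.
elim: m u => [|m IH] u um uv; have [-> //|ne] := eqVneq u v; try exact: connect0.
  have [a [_ ia] _] := rkle_cov uv ne; have := ninv_bound a; lia.
have [a [sa ia] av] := rkle_cov uv ne.
apply: (@connect_trans _ _ a); first by apply/connect1/bruhat_stepP.
by apply: IH => //; have := ninv_bound a; lia.
Qed.

Lemma bruhat_ninv u v : bruhat u v -> u != v -> ninv u < ninv v.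
Proof.
move=> /connectP[s sp ->] {v}; case: s sp => [|a s] /=; first by rewrite eqxx.
move=> /andP[/bruhat_stepP/step_ninv ua sp] _; elim: s a sp ua => [|b s IH] a //=.
by move=> /andP[/bruhat_stepP/step_ninv ab sp] ua; apply: IH sp (ltn_trans ua ab).
Qed.

Lemma bruhat_ninv_le u v : bruhat u v -> ninv u <= ninv v.
Proof. by move=> uv; case: (eqVneq u v) => [->//|/(bruhat_ninv uv)/ltnW]. Qed.

Lemma bruhat_refl u : bruhat u u. Proof. exact: connect0. Qed.

Lemma bruhat_trans v u x : bruhat u v -> bruhat v x -> bruhat u x.
Proof. exact: connect_trans. Qed.

Lemma bruhat_antisym u v : bruhat u v -> bruhat v u -> u = v.
Proof.
move=> uv vu; apply/eqP; apply: contraT => ne.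
by have := bruhat_ninv uv ne; rewrite ltnNge bruhat_ninv_le.
Qed.

Lemma step_bruhat u v : step u v -> bruhat u v.
Proof. by move=> s; apply/connect1/bruhat_stepP. Qed.

Lemma bruhat_cov u v : bruhat u v -> u != v -> exists2 a, cov u a & bruhat a v.
Proof. by move=> /bruhatP uv ne; have [a ua /bruhatP] := rkle_cov uv ne; exists a. Qed.

(** Otherwise every inversion of [v] is one of [u], against the strict growth of [ninv]. *)
Lemma inversion_pair u v : bruhat u v -> u != v ->
  exists i j, [/\ i < j, u i < u j & v j < v i].
Proof.
move=> uv ne.
have [/existsP[i /existsP[j /and3P[]]]|H0] := boolP
  [exists i : 'I_n, exists j : 'I_n, [&& i < j, u i < u j & v j < v i]].
  by exists i, j.
have := bruhat_ninv uv ne; rewrite ltnNge => /negP[].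
apply: leq_sum => i _; apply: leq_sum => j _.
case: (ltnP i j) => //= ij; case: (ltnP (v j) (v i)) => //= vji.
case: (ltngtP (u j) (u i)) => // [uij|/val_inj/perm_inj E]; last by rewrite E ltnn in ij.
by case/negP: H0; apply/existsP; exists i; apply/existsP; exists j; rewrite ij uij vji.
Qed.

(* The pair i, j minimizes the distance j - i among those of inversion_pair, as in
   Tsukerman and Williams. *)
Lemma generalized_lifting u v : bruhat u v -> u != v ->
  exists i j, [/\ i < j, u i < u j & v j < v i] /\
    [/\ ninv (tperm i j * u)%g = (ninv u).+1,
        bruhat (tperm i j * u)%g v & bruhat u (tperm i j * v)%g].
Proof.
move=> uv ne; have [i0 [j0 P0]] := inversion_pair uv ne.
pose P (e : 'I_n * 'I_n) := [&& e.1 < e.2, u e.1 < u e.2 & v e.2 < v e.1].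
have {}P0 : P (i0, j0) by apply/and3P.
case: (@arg_minnP _ _ P (fun e : 'I_n * 'I_n => e.2 - e.1) P0) =>
  -[i j] /and3P[/= ij uij vji] Hmin.
have H1 k : i < k < j -> u i < u k -> v i < v k.
  move=> /andP[ik kj] uik; case: (ltngtP (v i) (v k)) => // [vik|/val_inj/perm_inj E].
    by have := Hmin (i, k); rewrite /P /= ik uik vik => /(_ isT); lia.
  by rewrite E ltnn in ik.
have H2 k : i < k < j -> u k < u j -> v k < v j.
  move=> /andP[ik kj] uik; case: (ltngtP (v k) (v j)) => // [vik|/val_inj/perm_inj E].
    by have := Hmin (k, j); rewrite /P /= kj uik vik => /(_ isT); lia.
  by rewrite E ltnn in kj.
(* By [H1], every entry of [u] counted between [i] and [p] is counted for [v] too; position [i]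
   counts for [v] only. *)
have left p q : i < p <= j -> u i < q <= v i -> rk u p q < rk v p q.
  move=> /andP[ip pj] /andP[uq qv]; rewrite !(@rk_split _ i p) ?(ltnW ip) //.
  rewrite -addnS; apply: leq_add; first exact: (bruhatP _ _ uv).
  apply: (@window_lt _ _ _ _ _ _ i); rewrite ?leqnn // => k /andP[ik kp] qk.
  have ik' : i < k.
    by rewrite ltn_neqAle ik andbT; apply/eqP=> E; move: qk; rewrite -(val_inj E); lia.
  by have := H1 k; rewrite ik' (leq_trans kp pj) => /(_ isT); lia.
(* Symmetrically, over the positions from [p] to [j] fewer entries are counted for [v] than for [u],
   while the rank of [v] at [j + 1] is at least that of [u]. Since [u i < u j] and [v j < v i], the
   two ranges of [q] cover both rectangles needed below. *)
have right p q : i < p <= j -> v j < q <= u j -> rk u p q < rk v p q.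
  move=> /andP[ip pj] /andP[vq qu].
  have pj1 : p <= j.+1 by apply: leqW.
  have := bruhatP _ _ uv j.+1 q; rewrite !(@rk_split _ p j.+1) //.
  suff : \sum_(k < n | p <= k < j.+1) (q <= v k) < \sum_(k < n | p <= k < j.+1) (q <= u k).
    by move: (bigop _ _ _) (bigop _ _ _); lia.
  apply: (@window_lt _ _ _ _ _ _ j); rewrite ?pj ?ltnSn // => k /andP[pk kj] qk.
  have kj' : k < j.
    by rewrite ltn_neqAle -ltnS kj andbT; apply/eqP=> E; move: qk; rewrite (val_inj E); lia.
  by have := H2 k; rewrite kj' (leq_trans ip pk) => /(_ isT); lia.
exists i, j; split; first by split.
split.
- apply: ninv_swapS => // a ija; apply/negP=> /andP[ua1 ua2].
  by have := H1 _ ija ua1; have := H2 _ ija ua2; lia.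
- apply/bruhatP/swap_le => //; first exact/bruhatP.
  move=> p q ipj /andP[uq qu].
  by case: (leqP q (v i)) => qv; [apply: left|apply: right]; rewrite // ?uq ?qu; lia.
- apply/bruhatP/swap_ge => //; first exact/bruhatP.
  move=> p q ipj /andP[vq qv].
  by case: (ltnP (u i) q) => uq; [apply: left|apply: right]; rewrite // ?uq ?vq; lia.
Qed.

End Rank.

(** * Connectedness of the atoms of an interval *)

Section Connected.
Variable n : nat.
Implicit Types (x y u v : 'S_n) (i j k l : 'I_n) (p q : nat).

Lemma tperm_mul i j k l :
  (tperm i j * tperm k l = tperm (tperm i j k) (tperm i j l) * tperm i j)%g.
Proof. by rewrite conjgCV tpermV tpermJ. Qed.

Lemma step_cov u x y : step u x -> step x y -> ninv y = (ninv u).+2 ->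
  cov u x /\ cov x y.
Proof.
move=> ux xy E; have := step_ninv ux; have := step_ninv xy; rewrite E => h1 h2.
by split; split=> //; lia.
Qed.

Lemma cov_bruhat u v : cov u v -> bruhat u v.
Proof. by case=> /step_bruhat. Qed.

Definition linked v x y := x = y \/ exists c, [/\ cov x c, cov y c & bruhat c v].

(* The element a0 swaps the first position i where u and v differ with the first later
   value in (u i, v i], as in Bjorner and Brenti, Theorem 2.1.5. An atom moving i is joined
   to a0 by one diamond, and any other atom is joined by one diamond to an atom moving i. *)
Lemma cov_linked u v : bruhat u v -> u != v -> exists a0, cov u a0 /\ bruhat a0 v /\
  forall b, cov u b -> bruhat b v ->
    exists b', [/\ cov u b', bruhat b' v, linked v b b' & linked v b' a0].
Proof.
move=> uv ne; have [i [H nei]] := first_diff ne.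
have [j [ij uj Hj]] := first_rise (bruhatP _ _ uv) H nei.
have [tv ti] := first_rise_swap (bruhatP _ _ uv) H ij uj Hj.
have stepI l : i < l -> u i < u l -> step u (tperm i l * u)%g by exists i, l.
have [uij ujv] := andP uj.
have ca : cov u (tperm i j * u)%g by split => //; apply: stepI.
exists (tperm i j * u)%g; split; first by [].
split; first exact/bruhatP.
(* The same canonical cover, now for an element [b] that agrees with [u] before [i] and is still
   below [v] at [i]. *)
have rise b : bruhat b v -> b i < v i -> (forall k, k < i -> b k = u k) ->
  exists j', [/\ i < j', b i < b j' <= v i,
    forall k, i < k < j' -> b i < b k <= v i = false,
    bruhat (tperm i j' * b)%g v & cov b (tperm i j' * b)%g].
  move=> bv bi bu.
  have Hb k : k < i -> b k = v k by move=> ki; rewrite bu ?H.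
  have nb : b i != v i by rewrite -val_eqE /= ltn_eqF.
  have [j' [ij' bj' Hj']] := first_rise (bruhatP _ _ bv) Hb nb.
  have [tv' ti'] := first_rise_swap (bruhatP _ _ bv) Hb ij' bj' Hj'.
  exists j'; split=> //; first exact/bruhatP.
  by split=> //; exists i, j'; case/andP: bj'.
have vbound l : bruhat (tperm i l * u)%g v -> i < l -> u l <= v i.
  move=> bv il; have := first_diff_le (bruhatP _ _ bv); rewrite -{1}(swapL u i l); apply.
  by move=> k ki; rewrite swapD ?H // -val_eqE /=; lia.
have caseI l : i < l -> u i < u l -> cov u (tperm i l * u)%g ->
    bruhat (tperm i l * u)%g v -> linked v (tperm i l * u)%g (tperm i j * u)%g.
  move=> il uil [_ cb] bv; have ulv := vbound l bv il.
  have [jl|nlj] := eqVneq j l; first by left; rewrite jl.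
  have jl : j < l.
    rewrite ltn_neqAle nlj /= leqNgt; apply/negP=> lj.
    by have := Hj l; rewrite il lj uil ulv => /(_ isT).
  have ulj : u l < u j.
    have := @ninv_swapS_between _ _ _ _ il uil cb j; rewrite ij jl uij => /(_ isT) /=.
    case: (ltngtP (u j) (u l)) => // /val_inj/perm_inj E.
    by rewrite E ltnn in jl.
  have bi : (tperm i l * u)%g i = u l by rewrite swapL.
  have bj : (tperm i l * u)%g j = u j by rewrite swapD // -val_eqE /=; lia.
  have [|k ki|j' [ij' bj' Hj' bv' cb']] := rise _ bv; first by rewrite bi; lia.
    by rewrite swapD // -val_eqE /=; lia.
  (* The first rise of this atom is again at [j], so its canonical cover also covers the canonical
     atom. *)
  have E : j' = j.
    apply: val_inj => /=; case: (ltngtP j' j) => // [j'j|jj'].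
      have := Hj j'; rewrite ij' j'j => /(_ isT).
      by move: bj'; rewrite bi swapD -?val_eqE /=; lia.
    by have := Hj' j; rewrite ij jj' bi bj ulj ujv => /(_ isT).
  right; exists (tperm i j' * (tperm i l * u))%g; split=> //.
  have eqc : (tperm i j' * (tperm i l * u) = tperm j l * (tperm i j * u))%g.
    by rewrite E !mulgA tperm_mul tpermL [tperm i j l]tpermD // -val_eqE /=; lia.
  suff [] : cov u (tperm i j * u)%g /\
    cov (tperm i j * u)%g (tperm i j' * (tperm i l * u))%g by [].
  apply: step_cov; first by case: ca.
    rewrite eqc; exists j, l; split=> //.
    by rewrite swapR swapD // -val_eqE /=; lia.
  by case: cb' => _ ->; rewrite cb.
move=> b [[k [l [kl ukl Eb]]] cb] bv.
have nkl := ltn_ord_neq kl.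
case: (ltngtP k i) => [ki|ik|/val_inj ki].
- have : b k <= v k.
    apply: first_diff_le (bruhatP _ _ bv) _ => m mk.
    by rewrite Eb swapD ?H // -?val_eqE /=; lia.
  by rewrite Eb swapL -H //; lia.
- have bi : b i = u i by rewrite Eb swapD // -val_eqE /=; lia.
  have [|m mi|j' [ij' bj' _ bv' [sb' cb']]] := rise _ bv.
  + by rewrite bi; lia.
  + by rewrite Eb swapD // -val_eqE /=; lia.
  have [ub _] := andP bj'; rewrite bi in ub.
  have cc : ninv (tperm i j' * b)%g = (ninv u).+2 by rewrite cb' cb.
  have nik : i != k by rewrite -val_eqE /=; lia.
  have nil : i != l by rewrite -val_eqE /=; lia.
  have nij' : i != j' by rewrite -val_eqE /=; lia.
  have [nki nli nlk nji] : [/\ k != i, l != i, l != k & j' != i].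
    by split; rewrite eq_sym.
  (* It suffices to reach the canonical cover of [b] from an atom that moves [i]: this atom is
     joined to [b] by that cover and to the canonical atom by [caseI]. *)
  have fin (m : 'I_n) : i < m -> u i < u m -> step (tperm i m * u)%g (tperm i j' * b)%g ->
    exists b', [/\ cov u b', bruhat b' v, linked v b b' & linked v b' (tperm i j * u)%g].
    move=> im uim sm; have [c1 c2] := step_cov (stepI m im uim) sm cc.
    have mv := bruhat_trans (cov_bruhat c2) bv'.
    exists (tperm i m * u)%g; split=> //; last exact: caseI.
    by right; exists (tperm i j' * b)%g; split.
  (* The product of the swaps of [i, j'] and [k, l] is rewritten so that a swap moving [i] acts
     first on [u]; which one depends on whether [j'] meets [k] or [l]. *)
  have [jk|jk] := eqVneq j' k.
    have bk : b k = u l by rewrite Eb swapL.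
    rewrite jk bk in ub.
    case: (ltngtP (u k) (u i)) => [uki|uik|/val_inj/perm_inj E].
    + apply: (fin l (ltn_trans ik kl) ub).
      exists k, l; rewrite swapR swapD //; split=> //.
      by rewrite Eb jk !mulgA [X in _ = (X * _)%g]tperm_mul tpermR tpermD.
    + apply: (fin k ik uik); exists i, l; rewrite swapL swapD //.
      split=> //; first exact: ltn_trans ik kl.
      by rewrite Eb jk !mulgA tperm_mul tpermR [tperm i k l]tpermD.
    + by rewrite E eqxx in nik.
  have [jl|jl] := eqVneq j' l.
    have bl : b l = u k by rewrite Eb swapR.
    rewrite jl bl in ub.
    apply: (fin k ik ub); exists k, l; rewrite swapR swapD //.
    split=> //; first exact: ltn_trans ub ukl.
    by rewrite Eb jl !mulgA [X in _ = (X * _)%g]tperm_mul tpermL tpermD.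
  have bj : b j' = u j' by rewrite Eb swapD.
  rewrite bj in ub.
  have [kj' lj'] : k != j' /\ l != j' by split; rewrite eq_sym.
  apply: (fin j' ij' ub); exists k, l; rewrite !swapD //; split=> //.
  by rewrite Eb !mulgA tperm_mul !tpermD.
- subst k; exists b; split=> //; first by split=> //; exists i, l.
    by left.
  by rewrite Eb; apply: caseI; rewrite -?Eb //; split=> //; exists i, l.
Qed.

End Connected.

(** * Products of two transpositions *)

Lemma tpermif (T : finType) (x y z : T) :
  tperm x y z = if z == x then y else if z == y then x else z.
Proof. by rewrite permE. Qed.

Ltac decide_eq a b :=
  let N := fresh "N" in let N' := fresh "N" in
  case: (eqVneq a b) => [?|/[dup]/negbTE N]; [subst|rewrite eq_sym => /negbTE N'].

Ltac eval_at H z := 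
  let E := fresh "E" in
  have E := H z; rewrite !tpermif in E;
  repeat first [rewrite eqxx in E
    | match goal with N : (_ == _) = false |- _ => rewrite N in E end].

Ltac apply_image_eq P :=
  match goal with E : fun_of_perm ?t ?x = ?y |- _ => exact: (P _ _ E) end.
Ltac refute_moved T3 F :=
  match goal with
  | E : fun_of_perm ?t ?x = ?y, E' : fun_of_perm ?t ?z = ?w |- _ =>
      apply: (F z z w _ E'); [apply: (T3 x y z E)|]; assumption
  end.

(* Brute force over the equalities between e, f, i, j, k, l: once they are decided, either
   one of the alternatives holds or tperm g h would move three points. The tactics run under
   try because substitution removes some of the variables. *)
Lemma tperm_mul_eq (T : finType) (e f g h i j k l : T) :
  e != f -> i != j -> k != l ->
  (tperm e f * tperm i j = tperm g h * tperm k l)%g ->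
  [\/ tperm i j = tperm k l, tperm e f = tperm i j,
      tperm e f = tperm k l | tperm g h = tperm i j].
Proof.
move=> ef ij kl H0.
have H z : tperm g h z = tperm k l (tperm i j (tperm e f z)).
  have -> : tperm g h = (tperm e f * tperm i j * tperm k l)%g.
    by rewrite H0 -!mulgA tperm2 mulg1.
  by rewrite !permM.
have P x y : tperm g h x = y -> (x == y) = false -> tperm g h = tperm x y.
  by case: tpermP => [->->|->->|_ _ ->]; rewrite ?eqxx // tpermC.
have T3 x y z : tperm g h x = y -> (x == y) = false -> (z == x) = false ->
    (z == y) = false -> tperm g h z = z.
  by move=> E /(P _ _ E) -> zx zy; rewrite tpermif zx zy.
have F x y z : tperm g h x = y -> tperm g h x = z -> (y == z) = false -> False.
  by move=> -> ->; rewrite eqxx.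
move: (tperm g h) H P T3 F => t H P T3 F {H0}.
have := ef; rewrite eq_sym => /negbTE ef'; move/negbTE: ef => ef.
have := ij; rewrite eq_sym => /negbTE ij'; move/negbTE: ij => ij.
have := kl; rewrite eq_sym => /negbTE kl'; move/negbTE: kl => kl.
try decide_eq i k; try decide_eq i l; try decide_eq j k; try decide_eq j l;
try decide_eq e i; try decide_eq e j; try decide_eq e k; try decide_eq e l;
try decide_eq f i; try decide_eq f j; try decide_eq f k; try decide_eq f l;
try congruence; 
try (by constructor 1; rewrite 1?tpermC); try (by constructor 2; rewrite 1?tpermC);
try (by constructor 3; rewrite 1?tpermC).
all: rewrite ?eqxx in ef ij kl => //.
all: try eval_at H i; try eval_at H j; try eval_at H k; try eval_at H l.
all: try eval_at H e; try eval_at H f.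
all: try (by constructor 4; apply_image_eq P).
all: try (by constructor 4; rewrite tpermC; apply_image_eq P).
all: exfalso.
all: try by refute_moved T3 F.
Qed.

(** * Linear spans of intervals *)

Local Open Scope ring_scope.

Section Geometry.
Variables (R : realType) (n : nat).
Implicit Types (x y u v : 'S_n) (i j k l : 'I_n) (c : 'rV[R]_n).


Notation pt := (@perm_point R n).

Definition dot c (x : 'rV[R]_n) : R := \sum_i c 0 i * x 0 i.

Lemma dotD c p q : dot c (p + q) = dot c p + dot c q.
Proof. by rewrite /dot -big_split; apply: eq_bigr => i _; rewrite mxE mulrDr. Qed.
Lemma dotZ c a p : dot c (a *: p) = a * dot c p.
Proof. by rewrite /dot mulr_sumr; apply: eq_bigr => i _; rewrite mxE mulrCA. Qed.
Lemma dotN c p : dot c (- p) = - dot c p.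
Proof. by rewrite -scaleN1r dotZ mulN1r. Qed.
Lemma dotB c p q : dot c (p - q) = dot c p - dot c q.
Proof. by rewrite dotD dotN. Qed.
Lemma dot0 c : dot c 0 = 0.
Proof. by rewrite -(scale0r 0) dotZ mul0r. Qed.
Lemma dot_ker c p : (p <= kermx c^T)%MS = (dot c p == 0).
Proof.
apply/sub_kermxP/eqP => [/matrixP/(_ 0 0)|E].
  by rewrite !mxE => E; rewrite -[RHS]E; apply: eq_bigr => i _; rewrite mxE mulrC.
apply/matrixP => i j; rewrite !ord1 !mxE -[RHS]E.
by apply: eq_bigr => k _; rewrite mxE mulrC.
Qed.

Definition root_vec i j : 'rV[R]_n := delta_mx 0 i - delta_mx 0 j.

Lemma dot_root c i j : dot c (root_vec i j) = c 0 i - c 0 j.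
Proof.
have dd k : dot c (delta_mx 0 k) = c 0 k.
  rewrite /dot (bigD1 k) //= big1 ?addr0 => [|l lk]; rewrite mxE ?eqxx ?mulr1 //.
  by rewrite (negbTE lk) andbF mulr0.
by rewrite dotB !dd.
Qed.

Lemma pt_swap x i j : i != j ->
  pt (tperm i j * x)%g = pt x + ((x j)%:R - (x i)%:R) *: root_vec i j.
Proof.
move=> ij; apply/rowP => k; rewrite !mxE eqxx /=.
have [->|ki] := eqVneq k i; first by rewrite swapL (negbTE ij) -!natr1 /=; ring.
have [->|kj] := eqVneq k j; first by rewrite swapR -!natr1 /=; ring.
by rewrite swapD //=; ring.
Qed.

Lemma step_pt x y : step x y ->
  exists i j, exists2 s : R, 0 < s &
    [/\ (i < j)%N, y = (tperm i j * x)%g & pt y = pt x + s *: root_vec i j].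
Proof.
case=> i [j [ij xij ->]]; exists i, j, ((x j)%:R - (x i)%:R).
  by rewrite subr_gt0 ltr_nat.
by split=> //; rewrite pt_swap // ltn_ord_neq.
Qed.

Lemma tperm_ord_inj i j k l : (i < j)%N -> (k < l)%N ->
  tperm i j = tperm k l -> i = k /\ j = l.
Proof.
move=> ij kl E; have := tpermL i j; rewrite {}E.
case: tpermP => [-> -> //|Ei Ej|_ _ Ei]; move: ij; first by rewrite Ei -Ej; lia.
by rewrite Ei ltnn.
Qed.

(* The condition 1 < l + m puts d beyond the line through a and b: the points u, a, d, b
   are in convex position in this cyclic order. *)
Lemma diamond u a b d : step u a -> step a d -> step u b -> step b d -> a != b ->
  exists l m : R, [/\ 0 < l, 0 < m, 1 < l + m &
    pt d - pt u = l *: (pt a - pt u) + m *: (pt b - pt u)].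
Proof.
move=> ua ad ub bd ab; have nu : (ninv u < ninv d)%N.
  exact: ltn_trans (step_ninv ua) (step_ninv ad).
have [i [j [s s0 [ij Ea Pa]]]] := step_pt ua.
have [e [f [t t0 [ef Ed Pd]]]] := step_pt ad.
have [k [l [s' s0' [kl Eb Pb]]]] := step_pt ub.
have [g [h [t' t0' [gh Ed' Pd']]]] := step_pt bd.
have : (tperm e f * tperm i j = tperm g h * tperm k l)%g.
  by apply: (mulIg u); rewrite -!mulgA -Ea -Eb -Ed -Ed'.
(* The first two alternatives give [a = b] or [d = u]. In the other two, an edge at [u] is parallel
   to the opposite edge, so one coefficient is 1 and the other a positive ratio. *)
case/tperm_mul_eq; rewrite ?ltn_ord_neq // => E.
- by case/eqP: ab; rewrite Ea Eb E.
- by move: nu; rewrite Ed Ea E mulgA tperm2 mul1g ltnn.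
- have [? ?] := tperm_ord_inj ef kl E; subst e f.
  exists 1, (t / s'); rewrite ltr01 ltrDl divr_gt0 //; split=> //.
  rewrite Pd Pa Pb scale1r ![_ + _ - pt u]addrC !addKr addrA addKr scalerA.
  by rewrite divfK ?gt_eqF.
- have [? ?] := tperm_ord_inj gh ij E; subst g h.
  exists (t' / s), 1; rewrite ltr01 ltrDr divr_gt0 //; split=> //.
  rewrite Pd' Pa Pb scale1r ![_ + _ - pt u]addrC !addKr addrA addKr scalerA.
  by rewrite divfK ?gt_eqF // addrC.
Qed.

(** The property [Phi] passes between atoms along the diamonds of [cov_linked]: the top [d]
    satisfies [pt d - pt u <= W], and since the coefficient of [b'] in the diamond relation is
    nonzero, [b'] inherits this. The induction hypothesis for [b'] and its cover [d] gives the rest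
    of [Phi b']. *)
Lemma cov_span (W : 'M[R]_n) u a v : bruhat a v -> cov u a ->
  (pt a - pt u <= W)%MS ->
  (forall z, bruhat a z -> bruhat z v -> (pt z - pt a <= W)%MS) ->
  forall z, bruhat u z -> bruhat z v -> (pt z - pt u <= W)%MS.
Proof.
move: {2}(ninv v - ninv u)%N (leqnn (ninv v - ninv u)%N) => m.
elim: m u a => [|m IH] u a um av ua aW avW.
  have := bruhat_ninv_le av; case: ua => _ ->; lia.
have uv : bruhat u v := bruhat_trans (cov_bruhat ua) av.
have nuv : u != v.
  by apply/eqP=> E; have := bruhat_ninv_le av; case: ua => _ ->; rewrite E; lia.
pose Phi b := (pt b - pt u <= W)%MS /\
  forall z, bruhat b z -> bruhat z v -> (pt z - pt b <= W)%MS.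
have tr b b' : cov u b -> cov u b' -> linked v b b' -> Phi b -> Phi b'.
  move=> ub ub' [<- //|[d [bd b'd dv]]] [bW bvW].
  have [<- //|bb'] := eqVneq b b'.
  have [l [p [_ p0 _ E]]] := diamond ub.1 bd.1 ub'.1 b'd.1 bb'.
  have dW : (pt d - pt u <= W)%MS.
    by rewrite -(subrKA (pt b)) addmx_sub // bvW // cov_bruhat.
  have b'W : (pt b' - pt u <= W)%MS.
    have -> : pt b' - pt u = p^-1 *: ((pt d - pt u) - l *: (pt b - pt u)).
      by rewrite E [_ + p *: _]addrC addrK scalerA mulVf ?scale1r ?gt_eqF.
    by rewrite scalemx_sub // addmx_sub // -scaleNr scalemx_sub.
  split=> //; apply: (IH b' d) => //.
  - by have := bruhat_ninv_le dv; case: ub' => _ ->; lia.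
  - by rewrite -(subrKA (pt u)) addmx_sub // -opprB -scaleN1r scalemx_sub.
  - move=> z dz zv; rewrite -(subrKA (pt b)) addmx_sub //.
      by rewrite bvW // (bruhat_trans (cov_bruhat bd)).
    by rewrite -opprB -scaleN1r scalemx_sub // bvW // cov_bruhat.
have sym b b' : linked v b b' -> linked v b' b.
  by case=> [->|[d [? ? ?]]]; [left|right; exists d].
have [a0 [ua0 [a0v H]]] := cov_linked uv nuv.
have Pa0 : Phi a0.
  by have [b' [? ? /(tr _ _)H1 /(tr _ _)H2]] := H _ ua av; apply/H2/H1.
have Pall b : cov u b -> bruhat b v -> Phi b.
  move=> ub bv; have [b' [ub' _ /sym L1 /sym L2]] := H _ ub bv.
  by apply: (tr _ _ ub' ub L1); apply: (tr _ _ ua0 ub' L2).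
move=> z uz zv; have [<-|nz] := eqVneq u z; first by rewrite subrr sub0mx.
have [b ub bz] := bruhat_cov uz nz.
have [bW bvW] := Pall _ ub (bruhat_trans bz zv).
by rewrite -(subrKA (pt b)) addmx_sub // bvW.
Qed.

(** The direction space of the affine hull of the interval polytope, see [affine_hull_polytope]. *)
Definition lin u v : 'M[R]_n :=
  (\sum_(z | bruhat u z && bruhat z v) <<pt z - pt u>>)%MS.

Lemma linP u v (W : 'M[R]_n) :
  reflect (forall z, bruhat u z -> bruhat z v -> (pt z - pt u <= W)%MS)
          (lin u v <= W)%MS.
Proof.
apply: (iffP sumsmx_subP) => H z.
  by move=> uz zv; rewrite -genmxE H // uz.
by case/andP=> uz zv; rewrite genmxE H.
Qed.

Lemma lin_in u v z : bruhat u z -> bruhat z v -> (pt z - pt u <= lin u v)%MS.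
Proof. by move=> uz zv; have /linP := submx_refl (lin u v); apply. Qed.

Lemma lin_cov u a v : cov u a -> bruhat a v ->
  (lin u v <= <<pt a - pt u>> + lin a v)%MS.
Proof.
move=> ua av; apply/linP; apply: cov_span av ua _ _.
  by apply: submx_trans (addsmxSl _ _); rewrite genmxE.
move=> z az zv; apply: submx_trans (addsmxSr _ _); exact: lin_in.
Qed.

Lemma rank_lin_cov u a v : cov u a -> bruhat a v ->
  (\rank (lin u v) <= (\rank (lin a v)).+1)%N.
Proof.
move=> ua av; apply: leq_trans (mxrankS (lin_cov ua av)) _.
apply: leq_trans (mxrank_adds_leqif _ _) _.
by rewrite genmxE -[X in (_ <= X)%N]add1n leq_add2r rank_leq_row.
Qed.

(** Each cover adds at most one dimension. This bounds the dimension of the polytope by the length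
    and, read the other way, bounds the rank of an upper interval from below. *)
Lemma rank_lin_chain u v w : bruhat u v -> bruhat v w ->
  (\rank (lin u w) <= \rank (lin v w) + (ninv v - ninv u))%N.
Proof.
move=> + vw; move: {2}(ninv v - ninv u)%N (leqnn (ninv v - ninv u)%N) => m.
elim: m u => [|m IH] u um uv; have [<-|nuv] := eqVneq u v;
  rewrite ?leq_addr //; try by (have := bruhat_ninv uv nuv; lia).
have [a ua av] := bruhat_cov uv nuv.
apply: leq_trans (rank_lin_cov ua (bruhat_trans av vw)) _.
have [sa Ea] := ua; have := bruhat_ninv_le av; rewrite Ea => le.
have /IH/(_ av) : (ninv v - ninv a <= m)%N by rewrite Ea; lia.
by rewrite Ea; move: (\rank _) (\rank _) => r1 r2; lia.
Qed.

Lemma rank_lin_le u v : bruhat u v -> (\rank (lin u v) <= ninv v - ninv u)%N.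
Proof.
move=> uv; apply: leq_trans (rank_lin_chain uv (bruhat_refl _)) _.
suff /eqP -> : \rank (lin v v) == 0%N by [].
rewrite mxrank_eq0 -submx0; apply/linP => z vz zv.
by rewrite (bruhat_antisym vz zv) subrr sub0mx.
Qed.

(** The lifting pair [i, j] moves up from [u] and down from [v] inside the interval. Maximality at
    both ends gives opposite inequalities between [c 0 i] and [c 0 j], so they agree and the atom
    above [u] is maximal too. Induct from that atom and apply [cov_span] to the kernel of [c]. *)
Lemma dot_max_const c (b : R) u v :
  (forall z, bruhat u z -> bruhat z v -> dot c (pt z) <= b) ->
  dot c (pt u) = b -> dot c (pt v) = b -> bruhat u v ->
  forall z, bruhat u z -> bruhat z v -> dot c (pt z) = b.
Proof.
move: {2}(ninv v - ninv u)%N (leqnn (ninv v - ninv u)%N) => m.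
elim: m u => [|m IH] u um mx ub vb uv z uz zv; have [E|nuv] := eqVneq u v.
- by rewrite -(bruhat_antisym uz) // E.
- have := bruhat_ninv uv nuv; lia.
- by rewrite -(bruhat_antisym uz) // E.
have [i [j [[ij uij vij] [ti tv ut]]]] := generalized_lifting uv nuv.
have nij := ltn_ord_neq ij.
have ua : cov u (tperm i j * u)%g by split=> //; exists i, j.
have m1 := mx _ (cov_bruhat ua) tv.
have m2 : dot c (pt (tperm i j * v)%g) <= b.
  apply: mx ut _; apply: step_bruhat; exists i, j.
  by rewrite swapL swapR mulgA tperm2 mul1g.
rewrite pt_swap // dotD dotZ dot_root ub in m1.
rewrite pt_swap // dotD dotZ dot_root vb in m2.
have u0 : 0 < (u j)%:R - (u i)%:R :> R by rewrite subr_gt0 ltr_nat.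
have v0 : (v j)%:R - (v i)%:R < 0 :> R by rewrite subr_lt0 ltr_nat.
have cij : c 0 i - c 0 j = 0.
  apply/eqP; rewrite eq_le; apply/andP; split.
    by rewrite -(pmulr_rle0 _ u0); lra.
  by rewrite -(nmulr_rle0 _ v0); lra.
have ab : dot c (pt (tperm i j * u)%g) = b.
  by rewrite pt_swap // dotD dotZ dot_root cij mulr0 addr0.
have H := IH _ _ _ ab vb tv.
suff : (pt z - pt u <= kermx c^T)%MS.
  by rewrite dot_ker dotB ub subr_eq0 => /eqP.
apply: (cov_span tv ua) uz zv.
  by rewrite dot_ker dotB ub ab subrr.
move=> y ay yv; rewrite dot_ker dotB ab H ?subrr //.
  by rewrite ti; lia.
by move=> t at_ tv'; apply: mx => //; apply: bruhat_trans (cov_bruhat ua) at_.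
Qed.

Definition atoms u v := [set a | [&& bruhat_step u a, ninv a == (ninv u).+1 & bruhat a v]].

Lemma atomsP u v a : reflect (cov u a /\ bruhat a v) (a \in atoms u v).
Proof.
rewrite inE; apply: (iffP and3P) => [[/bruhat_stepP s /eqP E ?]|[[s E] ?]] //.
by split=> //; [apply/bruhat_stepP|apply/eqP].
Qed.

(** For [z] above [u], the lifting pair gives a lower element that differs from [z] by a multiple of
    a root, and an atom that differs from [u] by a multiple of the same root. Induct on [ninv z]. *)
Lemma lin_atoms u v : (lin u v <= \sum_(a in atoms u v) <<pt a - pt u>>)%MS.
Proof.
apply/linP => z; move: {2}(ninv z) (leqnn (ninv z)) => m.
elim: m z => [|m IH] z zm uz zv; have [<-|nuz] := eqVneq u z;
  rewrite ?subrr ?sub0mx //; try by (have := bruhat_ninv uz nuz; lia).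
have [i [j [[ij uij zij] [ti tz ut]]]] := generalized_lifting uz nuz.
have nij := ltn_ord_neq ij.
have tzz : step (tperm i j * z)%g z.
  by exists i, j; rewrite swapL swapR mulgA tperm2 mul1g.
have tW : (pt (tperm i j * z)%g - pt u <= \sum_(a in atoms u v) <<pt a - pt u>>)%MS.
  apply: IH => //; last exact: bruhat_trans (step_bruhat tzz) zv.
  by have := step_ninv tzz; lia.
have aA : (tperm i j * u)%g \in atoms u v.
  by apply/atomsP; split; [split=> //; exists i, j | apply: bruhat_trans tz zv].
have rW : (root_vec i j <= \sum_(a in atoms u v) <<pt a - pt u>>)%MS.
  have : (pt (tperm i j * u)%g - pt u <= \sum_(a in atoms u v) <<pt a - pt u>>)%MS.
    by apply: (sumsmx_sup _ aA); rewrite genmxE.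
  rewrite pt_swap // [_ + _ - _]addrC addKr => /(scalemx_sub ((u j)%:R - (u i)%:R)^-1).
  by rewrite scalerA mulVf ?scale1r // subr_eq0 eqr_nat gtn_eqF.
move: tW; rewrite pt_swap // => tW.
set w := _ *: root_vec i j in tW.
have -> : pt z - pt u = (pt z + w - pt u) - w by rewrite [RHS]addrAC addrK.
by rewrite addmx_sub // -scaleNr scalemx_sub.
Qed.

Lemma rank_lin_atoms u v : (\rank (lin u v) <= #|atoms u v|)%N.
Proof.
apply: leq_trans (mxrankS (lin_atoms u v)) _.
rewrite -sum1_card.
apply: (@leq_trans (\sum_(a in atoms u v) \rank <<pt a - pt u>>)).
  exact: mxrank_sum_leqif.
by apply: leq_sum => a _; rewrite genmxE rank_leq_row.
Qed.

End Geometry.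

Local Open Scope classical_set_scope.
Local Open Scope ring_scope.

(** * Face lattice of the cube *)

Lemma convex_hull_ind (R : realType) n (A X : set 'rV[R]_n) :
  A `<=` X ->
  (forall x y (k : R), 0 <= k -> k <= 1 -> X x -> X y -> X (k *: x + (1 - k) *: y)) ->
  convex_hull A `<=` X.
Proof.
move=> AX H; apply: smallest_sub => // x y k /set_mem Xx /set_mem Xy; apply/mem_set.
by apply: H.
Qed.

Lemma convex_hull_dot_le (R : realType) n (A : set 'rV[R]_n) c b :
  (forall x, A x -> dot c x <= b) -> forall x, convex_hull A x -> dot c x <= b.
Proof.
move=> H; apply: convex_hull_ind => // x y k k0 k1 /= xb yb.
rewrite dotD !dotZ; have -> : b = k * b + (1 - k) * b by ring.
by rewrite lerD // ler_wpM2l // subr_ge0.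
Qed.

Lemma convex_hull_face_generator (R : realType) n (A : set 'rV[R]_n) c b :
  (forall x, A x -> dot c x <= b) -> forall x, convex_hull A x -> dot c x = b ->
  exists2 y, A y & dot c y = b.
Proof.
move=> H x Ax cx; apply: contrapT => N.
suff : dot c x < b by rewrite cx ltxx.
move: x Ax {cx}; apply: convex_hull_ind => [y Ay /=|x y k k0 k1 /= xb yb].
  by rewrite lt_neqAle H // andbT; apply/eqP => E; apply: N; exists y.
rewrite dotD !dotZ; have [->|kn] := eqVneq k 0; first by rewrite mul0r add0r subr0 mul1r.
have -> : b = k * b + (1 - k) * b by ring.
have {kn} k0' : 0 < k by rewrite lt_neqAle eq_sym kn.
by apply: ltr_leD; [rewrite ltr_pM2l|apply: ler_wpM2l (ltW yb); rewrite subr_ge0].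
Qed.

Lemma subset_convex_hull (R : realType) n (A : set 'rV[R]_n) : A `<=` convex_hull A.
Proof. exact: sub_gen_smallest. Qed.

Lemma is_face_set0 (R : realType) n (P : set 'rV[R]_n) : is_face P set0.
Proof.
exists 0, 1; split=> [x _|]; first by rewrite big1 // => i _; rewrite mxE mul0r.
apply/seteqP; split=> // x [_]; rewrite big1 => [/eqP|i _]; last by rewrite mxE mul0r.
by rewrite eq_sym oner_eq0.
Qed.

Section Cubical.
Variable R : realType.

(* A pattern encodes a face of the cube: None marks a free coordinate. *)
Definition pattern_le d (s t : {ffun 'I_d -> option bool}) :=
  forall i e, t i = Some e -> s i = Some e.

Lemma pattern_le_anti d (s t : {ffun 'I_d -> option bool}) :
  pattern_le s t -> pattern_le t s -> s = t.
Proof.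
move=> st ts; apply/ffunP => i; case E: (t i) => [e|]; first exact: st.
by case E': (s i) => [e|//]; rewrite (ts _ _ E') in E.
Qed.

(** A labelling of the nonempty faces by those of the [d]-cube; the empty face carries no label. By
    [comb_equiv_cubeP] this amounts to combinatorial equivalence with the cube. *)
Definition cubical n (P : set 'rV[R]_n) d
    (G : {ffun 'I_d -> option bool} -> set 'rV[R]_n) :=
  [/\ forall s, is_face P (G s), forall s, G s !=set0,
      forall F, is_face P F -> F !=set0 -> exists s, F = G s
    & forall s t, G s `<=` G t <-> pattern_le s t].

Lemma cubical_inj n (P : set 'rV[R]_n) d (G : {ffun 'I_d -> option bool} -> _) :
  cubical P G -> injective G.
Proof. by case=> _ _ _ H s t E; apply: pattern_le_anti; apply/H; rewrite E. Qed.

Lemma cubical_comb_equiv m n (P : set 'rV[R]_m) (Q : set 'rV[R]_n) d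
    (G : {ffun 'I_d -> option bool} -> _) (G' : {ffun 'I_d -> option bool} -> _) :
  cubical P G -> cubical Q G' -> comb_equiv P Q.
Proof.
move=> cG cG'; have Ginj := cubical_inj cG; have Ginj' := cubical_inj cG'.
case: cG cG' => GF G0 GA Gle [GF' G0' GA' Gle'].
(* The correspondence of faces as a union over labels; a set without a label, such as [set0], goes
   to [set0]. *)
pose f (F : set 'rV[R]_m) := [set y | exists s, F = G s /\ G' s y].
have f0 : f set0 = set0.
  by apply/seteqP; split=> // y [s [E _]]; have [x] := G0 s; rewrite -E.
have fG s : f (G s) = G' s.
  by apply/seteqP; split=> [y [t [/Ginj<-]]|y] //; exists s.
have faceP F : is_face P F -> F = set0 \/ exists s, F = G s.
  move=> FF; have [->|/set0P ne] := eqVneq F set0; [by left|by right; exact: GA].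
have nG s : G s <> set0 by move=> E; have [x] := G0 s; rewrite E.
have nG' s : G' s <> set0 by move=> E; have [x] := G0' s; rewrite E.
exists f; first split.
- by move=> F /faceP[->|[s ->]]; rewrite ?f0 ?fG //; apply: is_face_set0.
- move=> F F' /set_mem/faceP[->|[s ->]] /set_mem/faceP[->|[t ->]]; rewrite ?f0 ?fG //.
  + by move=> /esym/nG'.
  + by move=> /nG'.
  + by move=> /Ginj'->.
- move=> F FF; have [->|/set0P ne] := eqVneq F set0.
    by exists set0 => //; apply: is_face_set0.
  by have [s ->] := GA' _ FF ne; exists (G s).
- move=> F F' /faceP[->|[s ->]] /faceP[->|[t ->]]; rewrite ?f0 ?fG.
  + by split=> _; apply: sub0set.
  + by split=> _; apply: sub0set.
  + by rewrite !subset0; split=> [/nG|/nG'].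
  + by rewrite Gle Gle'.
Qed.

Lemma comb_equiv_cubical m n (P : set 'rV[R]_m) (Q : set 'rV[R]_n) d
    (G' : {ffun 'I_d -> option bool} -> _) :
  cubical Q G' -> comb_equiv P Q ->
  exists G : {ffun 'I_d -> option bool} -> _, cubical P G.
Proof.
move=> [GF' G0' GA' Gle'] [f [ffun finj fsurj] fle].
have finj' F F' : is_face P F -> is_face P F' -> f F = f F' -> F = F'.
  by move=> FF FF'; apply: finj; apply/mem_set.
have Hex s : exists F, is_face P F /\ f F = G' s.
  by have [F FF E] := fsurj _ (GF' s); exists F.
pose G s := projT1 (cid (Hex s)).
have GF s : is_face P (G s) by rewrite /G; case: cid => F [].
have fG s : f (G s) = G' s by rewrite /G; case: cid => F [].
have f0 : f set0 = set0.
  have [F0 FF0 E] := fsurj _ (is_face_set0 Q).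
  apply/seteqP; split=> //; rewrite -E; apply/fle => //; exact: is_face_set0.
exists G; split=> //.
- move=> s; apply/set0P/eqP => E; have [x] := G0' s.
  by rewrite -fG E f0.
- move=> F FF ne; have : f F !=set0.
    apply/set0P/eqP; rewrite -f0 => /(finj' _ _ FF (is_face_set0 _)) E.
    by case: ne => x; rewrite E.
  by move=> /(GA' _ (ffun _ FF))[s E]; exists s; apply: finj' => //; rewrite fG.
- by move=> s t; rewrite fle // !fG Gle'.
Qed.

Definition cube_face d (s : {ffun 'I_d -> option bool}) : set 'rV[R]_d :=
  [set x | unit_cube R d x /\ forall i e, s i = Some e -> x 0 i = e%:R].

Definition cube_vertex d (t : 'I_d -> bool) : 'rV[R]_d := \row_i (t i)%:R.

Lemma cube_vertex_in d (t : 'I_d -> bool) : unit_cube R d (cube_vertex t).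
Proof. by move=> i; rewrite mxE; case: (t i); rewrite ?ler01 ?lexx. Qed.

(** Maximization is coordinatewise, and a coordinate is forced exactly where [c] has a nonzero
    entry. *)
Lemma cube_dot_max d (c x : 'rV[R]_d) : unit_cube R d x ->
  dot c x <= \sum_i Num.max (c 0 i) 0 ?= iff
    [forall i, ((0 < c 0 i) ==> (x 0 i == 1)) && ((c 0 i < 0) ==> (x 0 i == 0))].
Proof.
move=> cx; apply: leif_sum => i _.
have /andP[x0 x1] := cx i.
case: (ltrgtP (c 0 i) 0) => [ci|ci|->]; rewrite /= ?andbT.
- split; first by rewrite nmulr_rle0.
  by rewrite mulf_eq0 (lt_eqF ci).
- split; first by rewrite ger_pMr.
  by rewrite -subr_eq0 -{2}[c 0 i]mulr1 -mulrBr mulf_eq0 (gt_eqF ci) subr_eq0.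
- by rewrite mul0r; split=> //; apply: eqxx.
Qed.

Lemma cubical_cube d : cubical (unit_cube R d) (@cube_face d).
Proof.
have in_face (s : {ffun 'I_d -> option bool}) e :
    cube_face s (cube_vertex (fun i => odflt e (s i))).
  by split=> [|i e' E]; [exact: cube_vertex_in|rewrite mxE E].
split.
- move=> s.
  pose c : 'rV[R]_d := \row_i (if s i is Some e then (if e then 1 else -1) else 0).
  exists c, (\sum_i Num.max (c 0 i) 0); split=> [x /(cube_dot_max c)[] //|].
  apply/seteqP; split=> x [cx Hx]; split=> //; have [_ E] := cube_dot_max c cx.
    apply/eqP; rewrite [_ == _]E; apply/forallP => i; rewrite mxE.
    case Es: (s i) => [[]|]; last by rewrite ltxx.
      by rewrite ltr10 (Hx _ _ Es) eqxx implybT.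
    by rewrite oppr_gt0 ltr10 (Hx _ _ Es) eqxx implybT.
  move=> i e si; move/eqP: Hx; rewrite [_ == _]E => /forallP /(_ i); rewrite mxE si.
  case: e {si} => /andP[H1 H2]; first by move: H1; rewrite ltr01 => /eqP.
  by move: H2; rewrite oppr_lt0 ltr01 => /eqP.
- by move=> s; exists (cube_vertex (fun i => odflt true (s i))).
- move=> F [c [b [Hb ->]]] [x0 [cx0 E0]].
  pose s : {ffun 'I_d -> option bool} := [ffun i =>
    if 0 < c 0 i then Some true else if c 0 i < 0 then Some false else None].
  have sP x : (forall i e, s i = Some e -> x 0 i = e%:R) <->
      [forall i, ((0 < c 0 i) ==> (x 0 i == 1)) && ((c 0 i < 0) ==> (x 0 i == 0))].
    split=> [H|/forallP H i e].
      apply/forallP => i; move: (H i); rewrite ffunE.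
      by case: (ltrgtP (c 0 i) 0) => //= _ /(_ _ erefl) ->; rewrite eqxx.
    have := H i; rewrite ffunE.
    by case: (ltrgtP (c 0 i) 0) => //= _; rewrite ?andbT => /eqP -> [<-].
  exists s.
  have Eb : b = \sum_i Num.max (c 0 i) 0.
    apply/eqP; rewrite eq_le -{1}E0 (cube_dot_max c cx0) /=.
    set xm := cube_vertex (fun i => odflt true (s i)).
    have [cxm /sP xms] : cube_face s xm := in_face s true.
    have [_ E] := cube_dot_max c cxm.
    by move: E; rewrite xms => /eqP <-; apply: Hb.
  apply/seteqP; split=> x [cx Hx]; split=> //; have [_ E] := cube_dot_max c cx.
    by apply/sP; rewrite -E -Eb; apply/eqP.
  by apply/eqP; rewrite Eb [_ == _]E; apply/sP.
(* Test on the vertex of the face [s] whose free coordinates are all [~~ e]: lying in the face [t]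
   forces [s i = Some e]. *)
- move=> s t; split=> [H i e ti|H x [cx Hx]].
    have [_ /(_ _ _ ti)] := H _ (in_face s (~~ e)).
    by rewrite mxE; case: (s i) => [[]|]; case: e {ti} => //= /eqP;
      rewrite ?oner_eq0 // eq_sym oner_eq0.
  by split=> // i e /H/Hx.
Qed.

Lemma comb_equiv_cubeP m (P : set 'rV[R]_m) d :
  comb_equiv P (unit_cube R d) <->
  exists G : {ffun 'I_d -> option bool} -> set 'rV[R]_m, cubical P G.
Proof.
split; first exact: (comb_equiv_cubical (@cubical_cube d)).
by case=> G cG; apply: cubical_comb_equiv cG (@cubical_cube d).
Qed.

End Cubical.

(** * Faces and dimension of a Bruhat interval polytope *)

Section LinearAlgebra.
Variables (R : realType) (n d : nat).
Variables (r k : 'I_d -> 'rV[R]_n).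
Hypothesis k_diag : forall i, dot (k i) (r i) != 0.
Hypothesis k_off : forall i j, i != j -> dot (k i) (r j) = 0.

Lemma dot_lincomb c (a : 'I_d -> R) : dot c (\sum_j a j *: r j) = \sum_j a j * dot c (r j).
Proof.
by elim/big_rec2: _ => [|j p q _ <-]; rewrite ?dot0 // dotD dotZ.
Qed.

Let A : 'M[R]_(d, n) := \matrix_i r i.

Lemma dual_mul (u : 'rV[R]_d) : u *m A = \sum_j u 0 j *: r j.
Proof. by rewrite mulmx_sum_row; apply: eq_bigr => j _; rewrite rowK. Qed.

Lemma dual_dot (u : 'rV[R]_d) i : dot (k i) (u *m A) = u 0 i * dot (k i) (r i).
Proof.
rewrite dual_mul dot_lincomb (bigD1 i) //= big1 ?addr0 // => j ji.
by rewrite k_off ?mulr0 // eq_sym.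
Qed.

Lemma dual_row_free : row_free A.
Proof.
apply: inj_row_free => u uA; apply/rowP => i; rewrite mxE.
have := dual_dot u i; rewrite uA dot0 => /esym/eqP.
by rewrite mulf_eq0 (negbTE (k_diag i)) orbF => /eqP.
Qed.

Lemma dual_rank m (W : 'M[R]_(m, n)) :
  (forall i, (r i <= W)%MS) -> (d <= \rank W)%N.
Proof.
move=> H; have := dual_row_free; rewrite /row_free => /eqP {1}<-.
by apply: mxrankS; apply/row_subP => i; rewrite rowK.
Qed.

(** The [r j] are independent by duality and, as [\rank W <= d], form a basis of [W]; the [k j] read
    off the coordinates. *)
Lemma dual_span m (W : 'M[R]_(m, n)) y :
  (forall i, (r i <= W)%MS) -> (\rank W <= d)%N -> (y <= W)%MS ->
  y = \sum_j (dot (k j) y / dot (k j) (r j)) *: r j.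
Proof.
move=> H Wd yW; have AW : (A <= W)%MS by apply/row_subP => i; rewrite rowK.
have WA : (W <= A)%MS.
  rewrite -(geq_leqif (mxrank_leqif_sup AW)); apply: leq_trans Wd _.
  by have := dual_row_free; rewrite /row_free => /eqP ->.
have /submxP[u yu] : (y <= A)%MS := submx_trans yW WA.
by rewrite {1}yu dual_mul; apply: eq_bigr => j _; rewrite yu dual_dot mulfK.
Qed.

End LinearAlgebra.

Section Polytope.
Variables (R : realType) (n : nat).
Implicit Types (x y z u v w : 'S_n).

Notation pt := (@perm_point R n).
Notation Q v w := (@bruhat_polytope R n v w).

Lemma perm_point_inj : injective pt.
Proof.
move=> x y /rowP E; apply/permP => i; apply: val_inj.
by have := E i; rewrite !mxE => /eqP; rewrite eqr_nat => /eqP[].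
Qed.

Lemma polytope_pt v w z : bruhat v z -> bruhat z w -> Q v w (pt z).
Proof.
by move=> vz zw; apply: subset_convex_hull; exists z => //; rewrite /bruhat_interval /= vz.
Qed.

Lemma polytope_le v w (c : 'rV[R]_n) b :
  (forall z, bruhat v z -> bruhat z w -> dot c (pt z) <= b) ->
  forall p, Q v w p -> dot c p <= b.
Proof.
by move=> H; apply: convex_hull_dot_le => p [z /andP[vz zw] <-]; apply: H.
Qed.

Lemma polytope_lin v w p : Q v w p -> (p - pt v <= lin R v w)%MS.
Proof.
move: p; apply: convex_hull_ind => [p [z /andP[vz zw] <-]|p q k _ _ /= pW qW].
  exact: lin_in.
have -> : k *: p + (1 - k) *: q - pt v = k *: (p - pt v) + (1 - k) *: (q - pt v).
  by rewrite !scalerBr addrACA -opprD -scalerDl [k + _]addrC subrK scale1r.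
by rewrite addmx_sub // scalemx_sub.
Qed.

Lemma face_pt v w F : is_face (Q v w) F -> F !=set0 ->
  exists z, [/\ bruhat v z, bruhat z w & F (pt z)].
Proof.
move=> [c [b [H ->]]] [p [Qp E]].
have [_ [z /andP[vz zw] <-] Ez] : exists2 q, (pt @` bruhat_interval v w) q & dot c q = b.
  apply: convex_hull_face_generator Qp E => q [z /andP[vz zw] <-].
  by apply: H; apply: polytope_pt.
by exists z; split=> //; split=> //; apply: polytope_pt.
Qed.

Lemma perm_point_sqr z : dot (pt z) (pt z) = \sum_(i < n) (i.+1%:R ^+ 2).
Proof.
rewrite [RHS](reindex_inj (@perm_inj _ z)).
by apply: eq_bigr => i _; rewrite mxE expr2.
Qed.

(** All permutation points have the same norm, so the gap is half the squared distance of the two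
    points. Thus [pt z] is exposed by its own functional. *)
Lemma dot_perm_point z y : dot (pt z) (pt y) <= dot (pt z) (pt z) ?= iff (y == z).
Proof.
pose S := \sum_(i < n) ((pt z) 0 i - (pt y) 0 i) ^+ 2.
have ES : S = (dot (pt z) (pt z) - dot (pt z) (pt y)) *+ 2.
  rewrite /S; under eq_bigr => i _ do rewrite sqrrB.
  rewrite big_split /= sumrB -/(dot _ _).
  have sq x : \sum_(i < n) (pt x) 0 i ^+ 2 = dot (pt x) (pt x) by apply: eq_bigr => i _.
  rewrite !sq (perm_point_sqr y) -(perm_point_sqr z) sumrMnl -/(dot _ _).
  by rewrite mulrnBl mulr2n; ring.
have S0 : 0 <= S by apply: sumr_ge0 => i _; apply: sqr_ge0.
split; first by rewrite -subr_ge0 -(pmulrn_lge0 _ (isT : (0 < 2)%N)) -ES.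
apply/eqP/eqP => [E|->//].
have : S = 0 by rewrite ES E subrr mul0rn.
move/eqP; rewrite psumr_eq0 => [/allP H|i _]; last exact: sqr_ge0.
apply: perm_point_inj; apply/rowP => i; apply/eqP; rewrite eq_sym -subr_eq0 -sqrf_eq0.
by apply: H; rewrite mem_index_enum.
Qed.

Lemma vertex_face v w z : bruhat v z -> bruhat z w -> is_face (Q v w) [set pt z].
Proof.
move=> vz zw; exists (pt z), (dot (pt z) (pt z)); split.
  by apply: polytope_le => y _ _; have [] := dot_perm_point z y.
apply/seteqP; split=> [p ->|p [Qp /eqP E]]; first by split=> //; apply: polytope_pt.
(* This alternative holds for the generators and is stable under convex combinations. *)
suff : dot (pt z) p < dot (pt z) (pt z) \/ p = pt z.
  by case=> // lt; move: lt; rewrite lt_neqAle /dot (eqP E) eqxx.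
move: p Qp {E}; apply: convex_hull_ind => [p [y _ <-]|p q k k0 k1 Hp Hq /=].
  have [le E] := dot_perm_point z y; have [->|ne] := eqVneq y z; [by right|left].
  by rewrite lt_neqAle E ne le.
have [->|kn0] := eqVneq k 0; first by rewrite scale0r add0r subr0 scale1r.
have [->|kn1] := eqVneq k 1; first by rewrite subrr scale0r addr0 scale1r.
have {k0 kn0} k0 : 0 < k by rewrite lt_neqAle eq_sym kn0.
have {k1 kn1} k1 : 0 < 1 - k by rewrite subr_gt0 lt_neqAle kn1.
have Ez : dot (pt z) (pt z) = k * dot (pt z) (pt z) + (1 - k) * dot (pt z) (pt z) by ring.
rewrite dotD !dotZ {1}Ez.
case: Hp Hq => [Hp|->] [Hq|->].
- by left; rewrite ltrD // ltr_pM2l.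
- by left; rewrite ltrD2r ltr_pM2l.
- by left; rewrite ltrD2l ltr_pM2l.
- by right; rewrite -scalerDl [k + _]addrC subrK scale1r.
Qed.

Lemma affine_hull_polytope v w : bruhat v w ->
  affine_hull (Q v w) = [set y | (y - pt v <= lin R v w)%MS].
Proof.
move=> vw; apply/seteqP; split=> y.
  move=> [k [x [a [xQ a1 ->]]]] /=.
  have -> : \sum_i a i *: x i - pt v = \sum_i a i *: (x i - pt v).
    under [RHS]eq_bigr => i _ do rewrite scalerBr.
    by rewrite sumrB -scaler_suml a1 scale1r.
  by apply: summx_sub => i _; rewrite scalemx_sub // polytope_lin.
move=> /= /sub_sumsmxP[u Eu].
have /choice[a Ea] : forall z, exists a, u z *m <<pt z - pt v>>%MS = a *: (pt z - pt v).
  by move=> z; apply/sub_rVP; rewrite -(genmxE (pt z - pt v)) submxMl.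
pose I z := bruhat v z && bruhat z w.
(* The coefficients [a] need not sum to 1; the deficit is put on [v], which does not affect
   differences from [pt v]. Outside the interval [b] is 0 and [x] takes the default [pt v]. *)
pose b z := (if I z then a z else 0) + (z == v)%:R * (1 - \sum_(z | I z) a z).
pose x z := if I z then pt z else pt v.
have Iv : I v by rewrite /I vw andbT; apply: bruhat_refl.
have sum_delta (V : lmodType R) (f : 'S_n -> V) (t : R) :
    \sum_z ((z == v)%:R * t) *: f z = t *: f v.
  rewrite (bigD1 v) //= eqxx mul1r big1 ?addr0 // => z /negbTE ->.
  by rewrite mul0r scale0r.
exists #|'S_n|, (fun i => x (enum_val i)), (fun i => b (enum_val i)); split.
- move=> i; rewrite /x; case: ifP => [/andP[]|_]; first exact: polytope_pt.
  by apply: polytope_pt => //; apply: bruhat_refl.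
- rewrite -(big_enum_val b) /= big_split /= -big_mkcond /=.
  have := sum_delta R^o (fun _ => 1) (1 - \sum_(z | I z) a z).
  rewrite /GRing.scale /= mulr1; under eq_bigr => z _ do rewrite mulr1.
  by move=> ->; rewrite addrC subrK.
- rewrite -(big_enum_val (fun z => b z *: x z)) /=.
  under eq_bigr => z _ do rewrite scalerDl.
  rewrite big_split /= sum_delta {2}/x Iv.
  have -> : \sum_z (if I z then a z else 0) *: x z = \sum_(z | I z) a z *: pt z.
    rewrite [RHS]big_mkcond; apply: eq_bigr => z _; rewrite /x.
    by case: ifP => _ //; rewrite scale0r.
  rewrite scalerBl scale1r scaler_suml addrCA -sumrB.
  rewrite -[LHS](subrKC (pt v)) Eu; congr (_ + _); apply: eq_bigr => z _.
  by rewrite Ea scalerBr.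
Qed.

Lemma has_dim_polytope v w k : bruhat v w ->
  has_dim (Q v w) k <-> \rank (lin R v w) = k.
Proof.
move=> vw; have E := affine_hull_polytope vw.
split=> [[x0 [U [EU <-]]]|rk]; last by exists (pt v), (lin R v w).
have H (y : 'rV[R]_n) : (y - pt v <= lin R v w)%MS = (y - x0 <= U)%MS.
  have /= Hy := congr1 (fun X => X y) (etrans (esym E) EU).
  by apply/idP/idP => h; [rewrite -Hy | rewrite Hy].
have v0 : (pt v - x0 <= U)%MS by rewrite -H subrr sub0mx.
have x00 : (x0 - pt v <= lin R v w)%MS by rewrite H subrr sub0mx.
apply/eqP; rewrite eqn_leq; apply/andP; split; apply: mxrankS.
  apply/linP => z vz zw; rewrite -(subrKA x0) addmx_sub //.
    by rewrite -H lin_in.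
  by rewrite -opprB -scaleN1r scalemx_sub.
apply/row_subP => i.
have -> : row i U = (x0 + row i U - pt v) - (x0 - pt v).
  by rewrite opprB addrA subrK addrC addKr.
by rewrite addmx_sub //; [rewrite H addrC addKr row_sub | rewrite -scaleN1r scalemx_sub].
Qed.

Lemma toricP v w : bruhat v w ->
  toric R v w <-> \rank (lin R v w) = (ninv w - ninv v)%N.
Proof. by move=> vw; rewrite /toric !perm_length_ninv; apply: has_dim_polytope. Qed.

(** Along a saturated chain each cover adds one to [ninv] and at least one element to the label. *)
Lemma grade_le (T : finType) (S : 'S_n -> {set T}) v w :
  (forall x y, bruhat v x -> bruhat x y -> bruhat y w -> x != y -> S x \proper S y) ->
  forall x y, bruhat v x -> bruhat x y -> bruhat y w ->
  (ninv y + #|S x| <= ninv x + #|S y|)%N.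
Proof.
move=> H x y; move: {2}(ninv y - ninv x)%N (leqnn (ninv y - ninv x)%N) => m.
elim: m x => [|m IH] x xm vx xy yw; have [->//|nxy] := eqVneq x y;
  try by (have := bruhat_ninv xy nxy; lia).
have [a xa ay] := bruhat_cov xy nxy; have ca := cov_bruhat xa.
have [_ Ea] := xa.
have := IH a ltac:(lia) (bruhat_trans vx ca) ay yw.
have : (#|S x| < #|S a|)%N.
  apply: proper_card; apply: H vx ca (bruhat_trans ay yw) _.
  by apply/eqP=> E; move: Ea; rewrite -E; lia.
by rewrite Ea; move: #|_| #|_| #|_|; lia.
Qed.

End Polytope.

(** * Cubes are toric and Boolean *)

Section Forward.
Variables (R : realType) (n : nat) (v w : 'S_n) (hvw : bruhat v w) (d : nat).
Variable G : {ffun 'I_d -> option bool} -> set 'rV[R]_n.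
Hypothesis cG : cubical (bruhat_polytope R v w) G.

Notation pt := (@perm_point R n).

Let I (z : 'S_n) := bruhat v z && bruhat z w.

Lemma vertex_patterns : exists tau : 'S_n -> {ffun 'I_d -> option bool},
  forall z, I z -> G (tau z) = [set pt z].
Proof.
suff /choice[tau H] : forall z, exists s, I z -> G s = [set pt z] by exists tau.
move=> z; case Iz: (I z); last by exists [ffun=> None].
have /andP[vz zw] := Iz; have [_ _ GA _] := cG.
by have [|s E] := GA _ (vertex_face R vz zw); [exists (pt z)|exists s].
Qed.

Let tau := projT1 (cid vertex_patterns).
Let tauE z : I z -> G (tau z) = [set pt z].
Proof. by move: z; rewrite /tau; case: cid. Qed.

Let Iv : I v. Proof. by rewrite /I hvw andbT; apply: bruhat_refl. Qed.

Lemma in_face_pattern z s : I z -> G s (pt z) <-> pattern_le (tau z) s.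
Proof.
by move=> Iz; have [_ _ _ Gle] := cG; rewrite -Gle tauE //; split=> [H _ ->|]; last exact.
Qed.

(** Fixing a free coordinate would give a nonempty face properly inside a single point. *)
Lemma tau_total z i : I z -> exists e, tau z i = Some e.
Proof.
move=> Iz; case E: (tau z i) => [e|]; first by exists e.
have [_ G0 _ Gle] := cG.
pose s := [ffun j => if j == i then Some true else tau z j] : {ffun _ -> _}.
have le : pattern_le s (tau z).
  by move=> j e tj; rewrite ffunE; case: eqP tj => [->|//]; rewrite E.
have : G s = [set pt z].
  have [p Gp] := G0 s; have sub : G s `<=` [set pt z] by rewrite -tauE //; apply/Gle.
  by apply/seteqP; split=> // q ->; rewrite -(sub _ Gp).
rewrite -tauE // => /(cubical_inj cG) /ffunP /(_ i).
by rewrite ffunE eqxx E.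
Qed.

(* Coordinates are flipped so that v gets the empty label. *)
Let S z := [set i | tau z i != tau v i]%SET.

Lemma S_facet z i : I z ->
  (i \notin S z) <-> G [ffun j => if j == i then tau v i else None] (pt z).
Proof.
move=> Iz; rewrite in_face_pattern // inE negbK.
have [e Ee] := tau_total i Iv; split=> [/eqP E j e'|/(_ i e)].
  by rewrite ffunE; case: eqP => // ->; rewrite E.
by rewrite ffunE eqxx Ee => /(_ erefl) ->.
Qed.

(** If [i] is not in [S z], the functional of the facet for [i] through [v] is maximal at [v] and
    [z], hence constant between them by [dot_max_const]; so the facet contains [x]. *)
Lemma S_mono x z : I x -> I z -> bruhat x z -> S x \subset S z.
Proof.
move=> Ix Iz xz; apply/fintype.subsetP => i; apply: contraTT.
move=> /S_facet - /(_ Iz) Fz; apply/S_facet => //.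
have := proj1 (S_facet i Iv); rewrite inE eqxx => /(_ isT) Fv.
have [GF _ _ _] := cG.
move: (GF [ffun j => if j == i then tau v i else None]) Fz Fv => [c [b [H ->]]].
move=> [_ Ez] [_ Ev].
have [/andP[vx xw] /andP[vz zw]] := (Ix, Iz).
split; first exact: polytope_pt.
apply: (dot_max_const _ Ev Ez vz vx xz) => y vy yz; apply: H.
by apply: polytope_pt => //; apply: bruhat_trans yz zw.
Qed.

Lemma S_inj x z : I x -> I z -> S x = S z -> x = z.
Proof.
move=> Ix Iz E; apply: (@perm_point_inj R).
suff Et : tau x = tau z.
  by have : [set pt x] (pt x) by []; rewrite -tauE // Et tauE.
apply/ffunP => i; move/finset.setP/(_ i): E; rewrite !inE.
have [a ->] := tau_total i Ix; have [b ->] := tau_total i Iz.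
by have [c ->] := tau_total i Iv; case: a; case: b; case: c.
Qed.

Lemma S_surj X : exists2 z, I z & S z = X.
Proof.
(* Flip the coordinates of [v] that lie in [X]. No coordinate stays free, so a vertex in this face
   has label [X]. *)
pose s := [ffun i => omap (fun e => (i \in X) (+) e) (tau v i)] : {ffun _ -> _}.
have [GF G0 _ _] := cG.
have [z [vz zw Gz]] := face_pt (GF s) (G0 s).
have Iz : I z by rewrite /I vz.
exists z => //; apply/finset.setP => i; rewrite inE.
have [e Ee] := tau_total i Iv.
move/(in_face_pattern s Iz): Gz => /(_ i); rewrite ffunE Ee /= => /(_ _ erefl) ->.
by case: (i \in X); case: e {Ee}.
Qed.

Lemma S_proper x z : bruhat v x -> bruhat x z -> bruhat z w -> x != z -> S x \proper S z.
Proof.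
move=> vx xz zw ne.
have Ix : I x by rewrite /I vx (bruhat_trans xz).
have Iz : I z by rewrite /I zw (bruhat_trans vx).
rewrite finset.properEneq S_mono // andbT; apply: contra ne => /eqP/S_inj -> //.
Qed.

Lemma S_bot : S v = finset.set0.
Proof. by apply/finset.setP => i; rewrite !inE eqxx. Qed.

Lemma S_top : S w = [set: 'I_d]%SET.
Proof.
have [z Iz E] := S_surj [set: 'I_d]%SET.
apply/eqP; rewrite finset.eqEsubset finset.subsetT -E; apply: S_mono => //.
  by rewrite /I hvw bruhat_refl.
by case/andP: Iz.
Qed.

(** The functionals of the facets through [v] are dual to the differences from [v] of the vertices
    labelled by singletons. *)
Lemma cube_dim_rank : (d <= \rank (lin R v w))%N.
Proof.
have /choice[z zP] : forall i : 'I_d, exists z, I z /\ S z = [set i]%SET.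
  by move=> i; have [z Iz E] := S_surj [set i]%SET; exists z.
have /choice[c cP] : forall i : 'I_d, exists c, forall x, I x ->
    (dot c (pt x - pt v) == 0) = (i \notin S x).
  move=> i; have [GF _ _ _] := cG.
  have [c [b [H E]]] := GF [ffun j => if j == i then tau v i else None].
  have cv : dot c (pt v) = b.
    have := proj1 (S_facet i Iv); rewrite inE eqxx => /(_ isT).
    by rewrite E => -[].
  exists c => x Ix; rewrite dotB cv subr_eq0; apply/eqP/idP => [e|].
    by apply/S_facet => //; rewrite E; split=> //; case/andP: Ix => ? ?; apply: polytope_pt.
  by move=> /S_facet - /(_ Ix); rewrite E => -[].
apply: (@dual_rank R n d (fun i => pt (z i) - pt v) c).
- by move=> i; have [Iz Sz] := zP i; rewrite cP // Sz inE eqxx.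
- move=> i j ij; have [Iz Sz] := zP j; apply/eqP; rewrite cP // Sz inE //.
- by move=> i; have [/andP[vz zw] _] := zP i; apply: lin_in.
Qed.

Lemma rank_dim : \rank (lin R v w) = (ninv w - ninv v)%N /\ d = (ninv w - ninv v)%N.
Proof.
have h1 := rank_lin_le R hvw; have h2 := cube_dim_rank.
have := grade_le S_proper (bruhat_refl _) hvw (bruhat_refl _).
rewrite S_bot S_top cards0 cardsT card_ord.
by have := bruhat_ninv_le hvw; move: (\rank _) h1 h2 => r; lia.
Qed.

(** As the total length is [d], applying [grade_le] to [[v, z]] and to [[z, w]] bounds [#|S z|] from
    both sides. *)
Lemma S_rank z : I z -> (#|S z| + ninv v = ninv z)%N.
Proof.
move=> /andP[vz zw]; have [_ Ed] := rank_dim.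
have := grade_le S_proper (bruhat_refl _) vz zw.
have := grade_le S_proper vz zw (bruhat_refl _).
rewrite S_bot S_top cards0 cardsT card_ord.
have := bruhat_ninv_le vz; have := bruhat_ninv_le zw.
by move: #|_| => c; lia.
Qed.

(** An atom label adds one element to [S z], so at most [d - #|S z|] labels are possible. There are
    at least that many atoms, because they span the directions of [[z, w]], whose rank is bounded
    below by [rank_lin_chain]. So every such label occurs. *)
Lemma S_atoms z i : I z -> i \notin S z ->
  exists2 a, a \in atoms z w & S a = (i |: S z)%SET.
Proof.
move=> Iz iz; have /andP[vz zw] := Iz.
have atomI a : a \in atoms z w -> I a /\ cov z a.
  case/atomsP=> za aw; split=> //.
  by rewrite /I aw (bruhat_trans vz) // cov_bruhat.
have Sinj : {in atoms z w &, injective S}.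
  by move=> a b /atomI[Ia _] /atomI[Ib _]; apply: S_inj.
have sub : (S @: atoms z w \subset (fun i => i |: S z)%SET @: (~: S z))%SET.
  apply/fintype.subsetP => _ /imsetP[a aA ->]; have [Ia [za Ea]] := atomI a aA.
  have Sza : S z \subset S a by apply: S_mono => //; apply: step_bruhat.
  have : #|(S a :\: S z)%SET| = 1%N.
    rewrite cardsD (finset.setIidPr Sza).
    have := S_rank Iz; have := S_rank Ia; rewrite Ea.
    by move: #|_| #|_|; lia.
  move/eqP/cards1P=> [j Ej]; apply/imsetP; exists j.
    have : j \in (S a :\: S z)%SET by rewrite Ej inE.
    by rewrite !inE => /andP[].
  by rewrite -Ej finset.setUC -[LHS](finset.setID _ (S z)) (finset.setIidPr Sza).
have : (i |: S z)%SET \in (S @: atoms z w)%SET.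
  suff /eqP -> : (S @: atoms z w == (fun i => i |: S z)%SET @: (~: S z))%SET.
    by apply: imset_f; rewrite inE.
  rewrite finset.eqEcard sub (card_in_imset Sinj).
  apply: leq_trans (leq_imset_card _ _) _.
  apply: leq_trans (rank_lin_atoms R z w).
  have := rank_lin_chain R vz zw; have [-> Ed] := rank_dim.
  have := S_rank Iz; have := cardsC (S z); rewrite card_ord.
  have := bruhat_ninv_le vz; have := bruhat_ninv_le zw.
  by move: (\rank _) #|_| #|_| => r c c'; lia.
by case/imsetP=> a aA ->; exists a.
Qed.

(** Climb from [x] by atoms, each adding one missing element of [S z]. *)
Lemma S_reflect x z : I x -> I z -> S x \subset S z -> bruhat x z.
Proof.
move: {2}#|_| (leqnn #|(S z :\: S x)%SET|) => m.
elim: m x => [|m IH] x xm Ix Iz xz.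
  move: xm; rewrite leqn0 cards_eq0 finset.setD_eq0 => zx.
  suff -> : x = z by apply: bruhat_refl.
  by apply: S_inj => //; apply/eqP; rewrite finset.eqEsubset xz.
have [E|ne] := eqVneq (S x) (S z); first by rewrite (S_inj Ix Iz E); apply: bruhat_refl.
have /properP[_ [i iz ix]] : S x \proper S z by rewrite finset.properEneq ne.
have [a /atomsP[xa aw] Sa] := S_atoms Ix ix.
have Ia : I a by rewrite /I aw (bruhat_trans _ (cov_bruhat xa)) //; case/andP: Ix.
apply: bruhat_trans (cov_bruhat xa) _; apply: IH => //.
  rewrite -ltnS; apply: leq_trans _ xm; apply: proper_card.
  apply/properP; split; first by rewrite Sa finset.setDS // finset.subsetUr.
  by exists i; rewrite finset.in_setD ?ix ?iz // Sa finset.setU11.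
by rewrite Sa finset.subUset finset.sub1set iz.
Qed.

Lemma cubical_boolean : toric R v w /\ boolean_interval v w.
Proof.
split; first by apply/toricP => //; case: rank_dim.
exists 'I_d; exists S; first split.
- by [].
- by move=> x z /set_mem Ix /set_mem Iz; apply: S_inj.
- by move=> X _; have [z Iz E] := S_surj X; exists z.
- by move=> x z Ix Iz; split; [apply: S_mono | apply: S_reflect].
Qed.

End Forward.

(** * Toric Boolean intervals give cubes *)

Local Open Scope set_scope.
Local Open Scope ring_scope.

Lemma boolean_labelling n (v w : 'S_n) : boolean_interval v w ->
  exists d (z : {set 'I_d} -> 'S_n), exists S : 'S_n -> {set 'I_d},
    [/\ cancel z S, forall x, bruhat v x -> bruhat x w -> z (S x) = x,
        forall X, bruhat v (z X) && bruhat (z X) w &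
        forall X Y, bruhat (z X) (z Y) = (X \subset Y)].
Proof.
move=> [T [g [gfun ginj gsurj] gle]].
pose S x : {set 'I_#|T|} := [set i | enum_val i \in g x]%SET.
have Sle x y : (S x \subset S y) = (g x \subset g y).
  apply/fintype.subsetP/fintype.subsetP => H t.
    by have := H (enum_rank t); rewrite !inE enum_rankK.
  by rewrite !inE; apply: H.
have /choice[z zP] : forall X, exists x, bruhat_interval v w x /\ S x = X.
  move=> X; have [x Ix E] := gsurj [set enum_val i | i in X]%SET Logic.I.
  exists x; split=> //; apply/finset.setP => i; rewrite inE E.
  by rewrite mem_imset //; apply: enum_val_inj.
exists #|T|, z, S; split=> [X|x vx xw|X|X Y]; try by have [] := zP X.
- have [Iz E] := zP (S x); apply: ginj.
  + exact/mem_set.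
  + by apply/mem_set; rewrite /bruhat_interval /= vx.
  + by apply/eqP; rewrite finset.eqEsubset -!Sle E fintype.subxx.
- have [IX EX] := zP X; have [IY EY] := zP Y.
  by rewrite -{2}EX -{2}EY Sle; apply/idP/idP => /(gle _ _ IX IY).
Qed.

Section Backward.
Variables (R : realType) (n : nat) (v w : 'S_n) (hvw : bruhat v w).
Variables (d : nat) (z : {set 'I_d} -> 'S_n) (S : 'S_n -> {set 'I_d}).
Hypothesis zK : cancel z S.
Hypothesis SK : forall x, bruhat v x -> bruhat x w -> z (S x) = x.
Hypothesis zI : forall X, bruhat v (z X) && bruhat (z X) w.
Hypothesis zle : forall X Y, bruhat (z X) (z Y) = (X \subset Y).
Hypothesis rk_vw : \rank (lin R v w) = (ninv w - ninv v)%N.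

Implicit Types (X Y : {set 'I_d}) (i j : 'I_d).

Notation pt := (@perm_point R n).
Let Q := bruhat_polytope R v w.

Lemma z_bot : z finset.set0 = v.
Proof.
have := SK (bruhat_refl v) hvw => <-; congr z; apply/eqP.
rewrite eq_sym -finset.subset0 -zle SK // ?bruhat_refl //.
by case/andP: (zI finset.set0).
Qed.

Lemma z_top : z [set: 'I_d]%SET = w.
Proof.
have := SK hvw (bruhat_refl w) => <-; congr z; apply/eqP.
rewrite eq_sym finset.eqEsubset finset.subsetT -zle SK // ?bruhat_refl //.
by case/andP: (zI [set: 'I_d]%SET).
Qed.

(** A cover of [z X] below [z (i |: X)] has a label between [X] and [i |: X] that differs from
    [X]. *)
Lemma z_cov X i : i \notin X -> cov (z X) (z (i |: X)).
Proof.
move=> iX; have le : bruhat (z X) (z (i |: X)) by rewrite zle finset.subsetUr.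
have ne : z X != z (i |: X).
  by rewrite (can_eq zK); apply: contra iX => /eqP ->; rewrite setU11.
have [a xa ay] := bruhat_cov le ne.
have va : bruhat v a by apply: bruhat_trans (cov_bruhat xa); case/andP: (zI X).
have aw : bruhat a w by apply: bruhat_trans ay _; case/andP: (zI (i |: X)).
suff E : S a = i |: X by rewrite -E SK.
have Xa : X \subset S a by rewrite -zle SK // cov_bruhat.
have aX : S a \subset i |: X by rewrite -zle SK.
apply/eqP; rewrite finset.eqEsubset aX finset.subUset Xa andbT finset.sub1set.
apply: contraT => ia; case: xa => _ Ea.
have : S a \subset X.
  apply/fintype.subsetP => j ja; have := fintype.subsetP aX _ ja.
  by rewrite !inE => /orP[/eqP E|//]; rewrite -E ja in ia.
by rewrite -zle SK // => /bruhat_ninv_le; rewrite Ea ltnn.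
Qed.

Lemma z_diamond X i j : i \notin X -> j \notin X -> i != j ->
  exists l m : R, [/\ 0 < l, 0 < m, 1 < l + m &
    pt (z (i |: (j |: X))) - pt (z X) =
      l *: (pt (z (j |: X)) - pt (z X)) + m *: (pt (z (i |: X)) - pt (z X))].
Proof.
move=> iX jX ij; have [s1 _] := z_cov jX; have [s2 _] := z_cov iX.
have [|s3 _] := @z_cov (j |: X) i; first by rewrite !inE negb_or ij.
have [|s4 _] := @z_cov (i |: X) j; first by rewrite !inE negb_or eq_sym ij.
rewrite finset.setUCA in s4; apply: diamond => //.
rewrite (can_eq zK); apply/eqP => /finset.setP /(_ i).
by rewrite !inE eqxx (negbTE ij) (negbTE iX).
Qed.

(** Inserting elements one at a time shows that [K] keeps its sign on all labels avoiding [i]. *)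
Lemma propagate_scaling i (K : {set 'I_d} -> R) :
  (forall X j, i \notin X -> j \notin X -> j != i ->
     exists2 p, 0 < p & K (j |: X) = p * K X) ->
  forall X, i \notin X -> exists2 p, 0 < p & K X = p * K finset.set0.
Proof.
move=> H X; move: {2}#|X| (erefl #|X|) => m.
elim: m X => [|m IH] X Xm iX.
  by exists 1; rewrite ?ltr01 // mul1r; move/eqP: Xm; rewrite cards_eq0 => /eqP ->.
have /card_gt0P[j jX] : (0 < #|X|)%N by rewrite Xm.
have [||p p0 Ep] := IH (X :\ j)%SET.
- by have := cardsD1 j X; rewrite jX Xm => -[].
- by rewrite !inE negb_and iX orbT.
have [|||q q0 Eq] := H (X :\ j)%SET j.
- by rewrite !inE negb_and iX orbT.
- by rewrite !inE eqxx.
- by apply: contraNneq iX => <-.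
by exists (q * p); rewrite ?mulr_gt0 // -mulrA -Ep -Eq finset.setD1K.
Qed.

(** Take a column of the cokernel of [lin R x y] that does not kill [lin R v w]; the ranks guarantee
    one. *)
Lemma rank_drop_functional (x y : 'S_n) : (\rank (lin R x y) < \rank (lin R v w))%N ->
  exists h : 'rV[R]_n, (forall t, bruhat x t -> bruhat t y -> dot h (pt t - pt x) = 0) /\
    exists X, dot h (pt (z X) - pt v) != 0.
Proof.
move=> lt.
have [t [k [vt tw tj]]] : exists t k,
    [/\ bruhat v t, bruhat t w & ((pt t - pt v) *m cokermx (lin R x y)) 0 k != 0].
  apply: contrapT => N; move: lt; rewrite ltnNge mxrankS //.
  apply/linP => t vt tw; rewrite submxE; apply/eqP/rowP => k; rewrite [RHS]mxE.
  by apply/eqP; apply: contraT => ne; case: N; exists t, k.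
have E p : dot (col k (cokermx (lin R x y)))^T p = (p *m cokermx (lin R x y)) 0 k.
  by rewrite mxE; apply: eq_bigr => m _; rewrite !mxE mulrC.
exists (col k (cokermx (lin R x y)))^T; split.
  move=> u xu uy; rewrite E; have := lin_in R xu uy.
  by rewrite submxE => /eqP ->; rewrite mxE.
by exists (S t); rewrite SK // E.
Qed.

Lemma dot_scaleL (h : 'rV[R]_n) (k : R) p : dot (k *: h) p = k * dot h p.
Proof. by rewrite /dot mulr_sumr; apply: eq_bigr => i _; rewrite mxE mulrA. Qed.

(* The functional vanishes on the differences inside [z [set i], w] if e, and inside
   [v, z (~: [set i])] otherwise. *)
Lemma facet_functional e i : exists (h : 'rV[R]_n) (b : R),
  forall X, (e = (i \in X) -> dot h (pt (z X)) = b) /\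
            (e != (i \in X) -> b < dot h (pt (z X))).
Proof.
(* It suffices that [h] has a constant strict sign on the opposite side: multiplying by the
   reference value [K] makes it positive. *)
suff [h [x [H0 [K [K0 KE]]]]] : exists (h : 'rV[R]_n) x,
    (forall X, e = (i \in X) -> dot h (pt (z X) - pt x) = 0) /\
    exists K : R, K != 0 /\ forall X, e != (i \in X) ->
       exists2 p, 0 < p & dot h (pt (z X) - pt x) = p * K.
  exists (K *: h), (dot (K *: h) (pt x)) => X; split=> [/H0|/KE[p p0]].
    by rewrite !dot_scaleL dotB => /eqP; rewrite subr_eq0 => /eqP ->.
  rewrite -subr_gt0 -dotB dot_scaleL => ->.
  by rewrite mulrCA pmulr_rgt0 // -expr2 exprn_even_gt0.
have [/andP[vz1 zw1] /andP[vz0 zw0]] := (zI [set i]%SET, zI (~: [set i])%SET).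
case: e.
(* The rank of [[v, w]] equals its length, so a shorter interval has smaller rank. *)
- have lt : (\rank (lin R (z [set i]%SET) w) < \rank (lin R v w))%N.
    apply: leq_ltn_trans (rank_lin_le R zw1) _; rewrite rk_vw.
    have : (ninv v < ninv (z [set i]%SET))%N.
      apply: bruhat_ninv vz1 _; rewrite -z_bot (can_eq zK) eq_sym.
      by apply/finset.set0Pn; exists i; rewrite inE.
    by have := bruhat_ninv_le zw1; lia.
  have [h [h0 [X0 hX0]]] := rank_drop_functional lt.
  pose H X := dot h (pt (z X) - pt (z [set i]%SET)).
  have H0 X : i \in X -> H X = 0.
    move=> iX; apply: h0; last by case/andP: (zI X).
    by rewrite zle finset.sub1set.
  have HB X Y : H X - H Y = dot h (pt (z X) - pt (z Y)) by rewrite /H -dotB opprB subrKA.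
  have HP X j : i \notin X -> j \notin X -> j != i -> exists2 p, 0 < p & H (j |: X) = p * H X.
    move=> iX jX ji; rewrite eq_sym in ji.
    have [l [m [l0 m0 lm E]]] := z_diamond iX jX ji.
    have := congr1 (dot h) E; rewrite -HB dotD !dotZ -!HB !(H0 (i |: _)) ?setU11 // => E'.
    (* [H] vanishes on labels containing [i], so the diamond relation leaves this factor, positive
       by convex position. *)
    exists ((l + m - 1) / l); first by rewrite divr_gt0 // subr_gt0.
    apply: (mulfI (lt0r_neq0 l0)); rewrite mulrA mulrCA divff ?lt0r_neq0 // mulr1.
    by lra.
  have HX X : i \notin X -> exists2 p, 0 < p & H X = p * H finset.set0.
    exact: propagate_scaling.
  exists h, (z [set i]%SET); split=> [X iX|]; first by apply: H0; rewrite -iX.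
  exists (H finset.set0); split; last by move=> X; rewrite eq_sym eqb_id => /HX.
  (* Otherwise [h] would be constant on all of [[v, w]]. *)
  apply: contraNneq hX0 => HE.
  have HZ X : H X = 0.
    have [/H0//|/HX[p _ ->]] := boolP (i \in X); by rewrite HE mulr0.
  by rewrite -z_bot -HB !HZ subrr.
- have lt : (\rank (lin R v (z (~: [set i])%SET)) < \rank (lin R v w))%N.
    apply: leq_ltn_trans (rank_lin_le R vz0) _; rewrite rk_vw.
    have : (ninv (z (~: [set i])%SET) < ninv w)%N.
      apply: bruhat_ninv zw0 _; rewrite -z_top (can_eq zK).
      by apply/eqP => /finset.setP /(_ i); rewrite !inE eqxx.
    by have := bruhat_ninv_le vz0; lia.
  have [h [h0 [X0 hX0]]] := rank_drop_functional lt.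
  pose H X := dot h (pt (z X) - pt v).
  have H0 X : i \notin X -> H X = 0.
    move=> iX; apply: h0; first by case/andP: (zI X).
    by rewrite zle finset.subsetC finset.sub1set inE.
  have HB X Y : H X - H Y = dot h (pt (z X) - pt (z Y)) by rewrite /H -dotB opprB subrKA.
  have HP X j : i \notin X -> j \notin X -> j != i ->
      exists2 p, 0 < p & H (i |: (j |: X)) = p * H (i |: X).
    move=> iX jX ji; rewrite eq_sym in ji.
    have [l [m [l0 m0 lm E]]] := z_diamond iX jX ji.
    have := congr1 (dot h) E; rewrite -HB dotD !dotZ -!HB (H0 X) // (H0 (j |: X)); last first.
      by rewrite !inE negb_or ji.
    (* Here the term with [l] vanishes and the factor is [m]. *)
    by rewrite !subr0 mulr0 add0r => ->; exists m.
  have HX X : i \in X -> exists2 p, 0 < p & H X = p * H (i |: finset.set0).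
    move=> iX; have [|p p0 E] := @propagate_scaling i (fun X => H (i |: X)) HP (X :\ i)%SET.
      by rewrite !inE eqxx.
    by exists p => //; rewrite -E finset.setD1K.
  exists h, v; split=> [X iX|]; first by apply: H0; rewrite -iX.
  exists (H (i |: finset.set0)); split; last by move=> X; rewrite negbK => /HX.
  apply: contraNneq hX0 => HE; rewrite -/(H X0).
  have [/HX[p _ ->]|/H0->//] := boolP (i \in X0); by rewrite HE mulr0.
Qed.

Lemma boolean_cubical :
  exists G : {ffun 'I_d -> option bool} -> set 'rV[R]_n, cubical Q G.
Proof.
have /choice[hb hbP] : forall ei : bool * 'I_d, exists hb : 'rV[R]_n * R,
    forall X, (ei.1 = (ei.2 \in X) -> dot hb.1 (pt (z X)) = hb.2) /\
              (ei.1 != (ei.2 \in X) -> hb.2 < dot hb.1 (pt (z X))).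
  by move=> [e i]; have [h [b H]] := facet_functional e i; exists (h, b).
pose h e i := (hb (e, i)).1; pose b e i := (hb (e, i)).2.
have heq e i X : e = (i \in X) -> dot (h e i) (pt (z X)) = b e i := (hbP (e, i) X).1.
have hlt e i X : e != (i \in X) -> b e i < dot (h e i) (pt (z X)) := (hbP (e, i) X).2.
have hge e i p : Q p -> b e i <= dot (h e i) p.
  move=> Qp; rewrite -lerN2 -[- dot _ _]mulN1r -dot_scaleL.
  apply: polytope_le Qp => y vy yw; rewrite -(SK vy yw) dot_scaleL mulN1r lerN2.
  by have [/heq->//|/hlt/ltW] := eqVneq e (i \in S y).
pose G (s : {ffun 'I_d -> option bool}) :=
  [set p | Q p /\ forall i e, s i = Some e -> dot (h e i) p = b e i]%classic.
have zQ X : Q (pt (z X)) by have /andP[? ?] := zI X; apply: polytope_pt.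
pose fill (s : {ffun 'I_d -> option bool}) e := [set i | odflt e (s i)].
have fillG s e : G s (pt (z (fill s e))).
  by split=> // i e' E; apply: heq; rewrite inE E.
exists G; split.
- move=> s.
  (* The face of [s] is cut out by the sum of its facet functionals, negated because [h e i] is
     minimal on its facet. *)
  pose c : 'rV[R]_n := \sum_i (if s i is Some e then - h e i else 0).
  pose bb := \sum_i (if s i is Some e then - b e i else 0).
  have cP p : Q p -> dot c p <= bb ?= iff
      [forall i, if s i is Some e then dot (h e i) p == b e i else true].
    move=> Qp; have -> : dot c p = \sum_i (if s i is Some e then - dot (h e i) p else 0).
      rewrite /dot; under eq_bigr => k _ do rewrite summxE mulr_suml.
      rewrite exchange_big; apply: eq_bigr => i _; case: (s i) => [e|].
        by rewrite -sumrN; apply: eq_bigr => k _; rewrite mxE mulNr.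
      by rewrite big1 // => k _; rewrite mxE mul0r.
    apply: leif_sum => i _; case: (s i) => [e|]; last by split=> //; apply: eqxx.
    by split; rewrite ?lerN2 ?hge // eqr_opp.
  exists c, bb; split=> [p /cP[] //|].
  apply/seteqP; split=> p [Qp H]; split=> //; have [_ E] := cP p Qp.
    by apply/eqP; rewrite [_ == _]E; apply/forallP => i; case Es: (s i) => [e|//]; rewrite H.
  move=> i e si; move/eqP: H; rewrite [_ == _]E => /forallP /(_ i).
  by rewrite si => /eqP.
- by move=> s; exists (pt (z (fill s true))).
- move=> F FF Fne; have [y [vy yw Fy]] := face_pt FF Fne.
  move: FF Fy => [c [b0 [cb ->]]] [Qy]; rewrite -/(dot c _) => cy; set X := S y.
  have {}cb p : Q p -> dot c p <= b0 := cb p.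
  have Ey : y = z X by rewrite SK.
  (* [z (tog i)] is the neighbour of [y] in direction [i], [r i] the edge vector, and [k i] the
     functional of the facet through [y] that this edge leaves. *)
  pose tog i := if i \in X then (X :\ i)%SET else (i |: X).
  have togE i j : (j \in tog i) = (j == i) (+) (j \in X).
    rewrite /tog; case: ifP => iX; rewrite !inE; have [->|//] := eqVneq j i.
      by rewrite iX.
    by rewrite iX.
  pose r i := pt (z (tog i)) - pt y.
  pose k i := h (i \in X) i.
  have ky i : dot (k i) (pt y) = b (i \in X) i by rewrite Ey heq.
  have k_diag i : 0 < dot (k i) (r i).
    rewrite /r dotB ky subr_gt0 hlt // togE eqxx addTb.
    by case: (i \in X).
  have k_off i j : i != j -> dot (k i) (r j) = 0.
    by move=> ij; rewrite /r dotB ky heq ?subrr // togE (negbTE ij).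
  have rl i : (r i <= lin R v w)%MS.
    rewrite /r -(subrKA (pt v)) addmx_sub //.
      by have /andP[? ?] := zI (tog i); apply: lin_in.
    by rewrite -opprB -scaleN1r scalemx_sub // lin_in.
  have ld : (\rank (lin R v w) <= d)%N.
    rewrite rk_vw.
    have Sp x x' : bruhat v x -> bruhat x x' -> bruhat x' w -> x != x' -> S x \proper S x'.
      move=> vx xx' x'w; have xw := bruhat_trans xx' x'w; have vx' := bruhat_trans vx xx'.
      rewrite finset.properEneq -zle !SK // xx' andbT; apply: contra => /eqP E.
      by rewrite -(SK vx xw) E SK.
    have := grade_le Sp (bruhat_refl v) hvw (bruhat_refl w).
    rewrite -z_bot -z_top !zK cards0 cardsT card_ord z_bot z_top; lia.
  have cr j : dot c (r j) <= 0 by rewrite /r dotB cy subr_le0 cb.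
  (* Coordinates of [p - pt y] in the basis of edge vectors. They are nonnegative on [Q], which
     therefore lies in the simplicial cone of edges at [y]. *)
  pose t p j := dot (k j) (p - pt y) / dot (k j) (r j).
  have tE p : Q p -> dot c p = b0 + \sum_j t p j * dot c (r j).
    move=> Qp; rewrite -dot_lincomb.
    rewrite -(@dual_span R n d r k (fun i => lt0r_neq0 (k_diag i)) k_off _ (lin R v w)) //.
      by rewrite dotB cy addrC subrK.
    rewrite -(subrKA (pt v)) addmx_sub ?polytope_lin //.
    by rewrite -opprB -scaleN1r scalemx_sub // lin_in.
  have t0 p j : Q p -> 0 <= t p j ?= iff (dot (k j) p == b (j \in X) j).
    move=> Qp; rewrite /t dotB ky; split.
      by rewrite divr_ge0 ?subr_ge0 ?hge // ltW.
    by rewrite eq_sym mulf_eq0 invr_eq0 (gt_eqF (k_diag j)) orbF subr_eq0.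
  (* Along an edge with [dot c (r j) = 0] the face is free; where this is negative, the coordinate
     [t p j] must be 0, that is, [p] lies on the facet of [k j]. *)
  pose s : {ffun 'I_d -> option bool} :=
    [ffun j => if dot c (r j) < 0 then Some (j \in X) else None].
  exists s; apply/seteqP; split=> p [Qp H]; split=> //.
    move=> j e; rewrite ffunE; case: ltP => // cj [<-].
    have /eqP : \sum_j t p j * - dot c (r j) = 0.
      apply/eqP; rewrite -oppr_eq0 -sumrN; apply/eqP.
      have := tE p Qp; rewrite [dot c p]H => /esym/eqP.
      rewrite -subr_eq0 addrC addKr => /eqP Z.
      rewrite -[RHS]Z.
      by apply: eq_bigr => i _; rewrite mulrN opprK.
    rewrite psumr_eq0 => [/allP /(_ j)|i _]; last first.
      by rewrite mulr_ge0 ?oppr_ge0 // (t0 p i Qp).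
    rewrite mem_index_enum mulf_eq0 oppr_eq0 (lt_eqF cj) orbF => /(_ isT).
    by rewrite eq_sym (t0 p j Qp).2 => /eqP.
  rewrite [LHS]tE // big1 ?addr0 // => j _.
  have [cj|cj] := ltP (dot c (r j)) 0; last first.
    have -> : dot c (r j) = 0 by apply/eqP; rewrite eq_le cr cj.
    by rewrite mulr0.
  have [_ E] := t0 p j Qp; have := H j (j \in X); rewrite ffunE cj => /(_ erefl) /eqP.
  by rewrite -E => /eqP <-; rewrite mul0r.
- move=> s s'; split=> [H i e si|H p [Qp Hp]]; last by split=> // i e /H/Hp.
  have [_ /(_ _ _ si) E] := H _ (fillG s (~~ e)).
  case Es: (s i) => [e'|]; last first.
    have ne : e != ~~ e by case: (e).
    by have := @hlt e i (fill s (~~ e)); rewrite E ltxx inE Es /= => /(_ ne).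
  congr Some; apply/eqP; rewrite eq_sym; apply: contraT => ne.
  by have := @hlt e i (fill s (~~ e)); rewrite E ltxx inE Es /= ne => /(_ isT).
Qed.

End Backward.

Theorem theorem1p3 (R : realType) (n : nat) (v w : 'S_n) (hvw : bruhat v w) :
  (exists d : nat, comb_equiv (bruhat_polytope R v w) (unit_cube R d)) <->
  (toric R v w /\ boolean_interval v w).
Proof.
split=> [[d /comb_equiv_cubeP[G cG]]|[/(toricP R hvw) rk /boolean_labelling]].
  exact: (cubical_boolean hvw cG).
move=> [d [z [S [zK SK zI zle]]]]; exists d; apply/comb_equiv_cubeP.
exact: boolean_cubical zK SK zI zle rk.
Qed.
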